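(* Let $s>2$ and let $u_0\in H^s(\mathbb{T}^2;\mathbb{R}^2)$ with $\nabla\cdot u_0=0$. Then there exists $T>0$ (depending only on $s$ and $\|u_0\|_{H^s}$) such that for every integer $N\ge 2$, every viscosity $\nu>0$ and every $M\in\mathbb{Z}^+$, the sequence $(u^n)$ produced with time step $\tau=\frac{T}{M}$ (no restriction on the size of $\tau$) by the semi-implicit Fourier spectral scheme $$\begin{cases}\dfrac{u^{n+1}-u^n}{\tau}+\Pi_N(u^{n}\cdot\nabla u^{n+1})+\nabla p^n=\nu\Delta u^{n+1},\\ \nabla\cdot u^{n+1}=0,\\ u^0=\Pi_N u_0\end{cases}$$ satisfies the following for all $0\le n\le M$: (i) (the $L^2$ energy dissipates in time) $\|u^{n+1}\|_{L^2}\le\|u^n\|_{L^2}$; (ii) (the $H^s$ norm is uniformly bounded) $\sup_{n\le M}\|u^n\|_{H^s}\le 4\|u_0\|_{H^s}$.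
   Context: $\mathbb{T}^2=(\mathbb{R}/2\pi\mathbb{Z})^2$ with periodic boundary conditions. For $N\ge2$, $X_N=\mathrm{span}\{\cos(k\cdot x),\sin(k\cdot x): k=(k_1,k_2)\in\mathbb{Z}^2,\ |k|_\infty=\max\{|k_1|,|k_2|\}\le N\}$, and $\Pi_N$ is the Fourier truncation operator onto the modes $|k|_\infty\le N$ (acting componentwise on vector fields). All iterates $u^n$ have components in $X_N$ and are divergence free. Let $\mathbb{P}$ be the Leray projection, i.e. the $L^2$-orthogonal projection onto divergence-free fields: $\mathbb{P}v=v-\nabla q$ where $\Delta q=\nabla\cdot v$ on $\mathbb{T}^2$. The scheme is equivalent to $$\frac{u^{n+1}-u^n}{\tau}+\mathbb{P}\Pi_N(u^n\cdot\nabla u^{n+1})=\nu\Delta u^{n+1},\qquad u^0=\Pi_Nu_0,$$ with the pressure gradient $\nabla p^n$ determined by the divergence-free constraint. The scheme is used to approximate the incompressible Euler equations $\partial_t v+v\cdot\nabla v+\nabla q=0$, $\nabla\cdot v=0$, $v|_{t=0}=u_0$ on $\mathbb{T}^2$. With $\hat f(k)=\int_{\mathbb{T}^2}f(x)e^{-ik\cdot x}\,dx$, the Sobolev norm is $\|f\|_{H^s}=\frac{1}{2\pi}\big(\sum_{k\in\mathbb{Z}^2}(1+|k|^{2s})|\hat f(k)|^2\big)^{1/2}$. *)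

(* Defs.v *)
From HB Require Import structures.
From mathcomp Require Import all_boot all_order all_algebra.
From mathcomp Require Import complex zify.
From mathcomp Require Import all_classical all_reals all_analysis.

Set Implicit Arguments.
Unset Strict Implicit.
Unset Printing Implicit Defensive.

Import Order.TTheory GRing.Theory Num.Theory.
Import numFieldNormedType.Exports.

Local Open Scope classical_set_scope.
Local Open Scope ring_scope.

(* Functions on the torus are represented by functions on the plane that are
   2 pi-periodic in each variable; integrals over the torus are Lebesgue
   integrals over [0, 2 pi] x [0, 2 pi]. *)
Section Torus.
Context {R : realType}.
Implicit Types (f p : R * R -> R) (u v : R * R -> R * R) (k : int * int)
  (x : R * R) (N : nat) (s : R).

(* Lebesgue measure lives on the Borel sigma-algebra carried by
   [measurableTypeR R]; [plane] is R * R with the product of these. *)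
Definition plane : measurableType _ :=
  (measurableTypeR R * measurableTypeR R)%type.

Definition mu2 : {measure set plane -> \bar R} :=
  (@lebesgue_measure R \x @lebesgue_measure R)%E.

Definition cell : set (R * R) := `[0, 2 * pi] `*` `[0, 2 * pi].

Definition biperiodic f : Prop := forall x,
  f (x.1 + 2 * pi, x.2) = f x /\ f (x.1, x.2 + 2 * pi) = f x.

Definition cmp1 u : R * R -> R := fun x => (u x).1.
Definition cmp2 u : R * R -> R := fun x => (u x).2.

Definition componentwise (L : (R * R -> R) -> (R * R -> R)) u :
  R * R -> R * R := fun x => (L (cmp1 u) x, L (cmp2 u) x).

Definition d1 f : R * R -> R := fun x => 'D_(1, 0) f x.
Definition d2 f : R * R -> R := fun x => 'D_(0, 1) f x.

Definition grad p : R * R -> R * R := fun x => (d1 p x, d2 p x).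
Definition div u : R * R -> R := fun x => d1 (cmp1 u) x + d2 (cmp2 u) x.
Definition laplacian f : R * R -> R := fun x => d1 (d1 f) x + d2 (d2 f) x.
Definition advect u f : R * R -> R :=
  fun x => (u x).1 * d1 f x + (u x).2 * d2 f x.

(* [partials w f] applies d1 (for true) and d2 (for false) along the word w. *)
Definition partials (w : seq bool) f : R * R -> R :=
  foldr (fun (b : bool) g => if b then d1 g else d2 g) f w.

(* All iterated partial derivatives exist and are (Frechet) differentiable,
   hence continuous. *)
Definition smooth f : Prop :=
  forall (w : seq bool) x, differentiable (partials w f) x.

(* div u = 0 in the sense of distributions on the torus. *)
Definition weakly_div_free u : Prop := forall phi : R * R -> R,
  biperiodic phi -> smooth phi ->
  \int[mu2]_(x in cell) ((u x).1 * d1 phi x + (u x).2 * d2 phi x) = 0.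

Definition dotk k x : R := k.1%:~R * x.1 + k.2%:~R * x.2.

Definition expi (t : R) : R[i] := Complex (cos t) (sin t).

(* The integral of f(x) e^{-ik.x} for real-valued f, by real and imaginary
   parts. *)
Definition fourier f k : R[i] :=
  Complex (\int[mu2]_(x in cell) (f x * cos (dotk k x)))
          (\int[mu2]_(x in cell) (f x * - sin (dotk k x))).

Definition normk k : R := Num.sqrt (k.1%:~R ^+ 2 + k.2%:~R ^+ 2).

Definition modes N : seq (int * int) :=
  [seq (i%:Z - N%:Z, j%:Z - N%:Z) | i <- iota 0 (2 * N).+1,
                                    j <- iota 0 (2 * N).+1].

Definition in_XN N f : Prop := exists a b : int * int -> R, forall x,
  f x = \sum_(k <- modes N) (a k * cos (dotk k x) + b k * sin (dotk k x)).

(* The sum of (2 pi)^-2 \hat f(k) e^{ik.x} over |k|_oo <= N is real because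
   the modes are symmetric and f is real-valued, so taking the real part of
   each term loses nothing. *)
Definition PiN N f : R * R -> R := fun x =>
  ((2 * pi) ^+ 2)^-1 *
  \sum_(k <- modes N) complex.Re (fourier f k * expi (dotk k x)).

Definition L2norm u : \bar R :=
  sqrte (\int[mu2]_(x in cell) (((u x).1 ^+ 2 + (u x).2 ^+ 2)%:E))%E.

Definition Hsnorm s u : \bar R :=
  (((2 * pi)^-1)%:E *
   sqrte (\esum_(k in [set: int * int])
     ((1 + normk k `^ (2 * s)) *
      (Normc.normc (fourier (cmp1 u) k) ^+ 2 +
       Normc.normc (fourier (cmp2 u) k) ^+ 2))%:E))%E.

Definition in_Hs s u : Prop :=
  [/\ biperiodic (cmp1 u) /\ biperiodic (cmp2 u),
      measurable_fun [set: plane] (cmp1 u) /\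
      measurable_fun [set: plane] (cmp2 u),
      (L2norm u < +oo)%E
    & (Hsnorm s u < +oo)%E].

(* (u^n) for n <= M + 1 together with the pressures p^n for n <= M. *)
Record semi_implicit_scheme (N : nat) (nu tau : R) (M : nat)
    (u0 : R * R -> R * R) (u : nat -> R * R -> R * R)
    (p : nat -> R * R -> R) : Prop := {
  scheme_init : forall x, u 0%N x = componentwise (PiN N) u0 x ;
  scheme_XN : forall n, (n <= M.+1)%N ->
    in_XN N (cmp1 (u n)) /\ in_XN N (cmp2 (u n)) ;
  scheme_pressure : forall n, (n <= M)%N ->
    biperiodic (p n) /\ forall x, differentiable (p n) x ;
  scheme_step : forall n, (n <= M)%N -> forall x,
    tau^-1 *: (u n.+1 x - u n x)
      + componentwise (PiN N) (componentwise (advect (u n)) (u n.+1)) x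
      + grad (p n) x
    = nu *: componentwise laplacian (u n.+1) x ;
  scheme_div : forall n, (n <= M)%N -> forall x, div (u n.+1) x = 0
}.

End Torus.

Lemma mem_modes (N : nat) (k : int * int) :
  (k \in modes N) = (maxn `|k.1|%N `|k.2|%N <= N)%N.
Proof.
apply/allpairsP/idP => [[[i j] [hi hj ->]]|].
  by move: hi hj; rewrite !mem_iota /=; lia.
case: k => k1 k2 h; rewrite /fst /snd in h.
exists (absz (k1 + N%:Z), absz (k2 + N%:Z)).
by rewrite !mem_iota; split=> /=; [lia | lia | congr pair; lia].
Qed.

Lemma modes_uniq (N : nat) : uniq (modes N).
Proof.
apply: allpairs_uniq; rewrite ?iota_uniq// => -[i j] [i' j'] _ _ /= [h1 h2].
by congr pair; lia.
Qed.

(* Main.v *)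
Require Import Defs.
From HB Require Import structures.
From mathcomp Require Import all_boot all_order all_algebra.
From mathcomp Require Import complex.
From mathcomp Require Import all_classical all_reals all_analysis.
From mathcomp Require Import measurable_realfun zify ring lra.
Import Order.TTheory GRing.Theory Num.Theory.
Import numFieldNormedType.Exports.
Local Open Scope classical_set_scope.
Local Open Scope ring_scope.

(* In Fourier coefficients each step of the scheme is a finite system.  Testing
   it with w(k) conj(u^{n+1}(k)) kills the pressure (its gradient is parallel
   to k) and makes the viscosity a good term.  The transport contribution
   t(k, m) = Re (i (m . u^n(k - m)) u^{n+1}(m) . conj(u^{n+1}(k))) is
   antisymmetric in (k, m), so it vanishes for w = 1, which gives the energy
   estimate; for w(k) = 1 + |k|^{2s} it only appears with the factor
   w(k) - w(m), which recovers the derivative lost in the advection term.  With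
   Sum_k |k| |u(k)| <= C |u|_{H^s}, valid for s > 2, one gets
   y_{n+1}^2 <= y_n y_{n+1} + tau C y_n y_{n+1}^2 for y_n = |u^n|_{H^s}, a
   discrete Riccati inequality that keeps y_n below 4 y_0 as long as
   n tau C y_0 <= 1/4. *)

(** * Power inequalities *)

Section RealInequalities.
Context {R : realType}.
Implicit Types (x y z s : R).

(** The advecting field is divergence free, so m . u^n(k - m) = k . u^n(k - m), and the derivative
    in a transfer term can be charged to the smaller of |k| and |m|. Only then does the product with
    w(k) - w(m) split into s derivatives on two factors and a single one on the third: when |k - m|
    is comparable to |k| and m is low, charging the larger frequency would put s + 1 derivatives on
    one factor. No condition on [tau] arises because the transported field and the test function are
    both u^{n+1}: the antisymmetry is exact at every step size. After division by y_{n+1} the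
    Riccati inequality is linear in y_{n+1}; it reads 1/y_n <= 1/y_{n+1} + tau C, which telescopes
    over n without smallness of a single step. Uniformity in [N] comes from lattice sums bounded
    independently of the box, uniformity in [nu] from discarding a term of good sign. The analytic
    obstacle is the passage from integrals to coefficients under weak assumptions: the initial field
    is only square integrable with zero divergence in the weak sense, and the pressure is only
    differentiable. *)

Lemma le_of_eq x y : x = y -> x <= y.
Proof. by move=> ->. Qed.

Lemma bernoulli_le (n : nat) x : 0 <= x <= 1 -> 1 - n%:R * (1 - x) <= x ^+ n.
Proof.
move=> /andP[x0 x1]; elim: n => [|n IH]; first by rewrite expr0; lra.
rewrite exprS -natr1.
have : x * (1 - n%:R * (1 - x)) <= x * x ^+ n by rewrite ler_wpM2l.
have : 0 <= n%:R * (1 - x) ^+ 2 by rewrite mulr_ge0 ?sqr_ge0.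
nra.
Qed.

(** A substitute for the mean value theorem that also covers y = 0. With t = y / x in [0, 1] and n a
    natural number above s, t^s >= t^n >= 1 - n (1 - t) by Bernoulli. *)
Lemma powR_sub_le s x y : 0 < s -> 0 <= y -> y <= x -> 0 < x ->
  x `^ s - y `^ s <= (Num.truncn s).+1%:R * (x - y) / x * x `^ s.
Proof.
move=> s0 y0 yx x0; set n := (Num.truncn s).+1.
have xu : x != 0 by rewrite gt_eqF.
have tE : y = x * (y / x) by field.
have t0 : 0 <= y / x by rewrite divr_ge0 // ltW.
have t1 : y / x <= 1 by rewrite ler_pdivrMr // mul1r.
have -> : y `^ s = x `^ s * (y / x) `^ s by rewrite {1}tE powRM // ltW.
have H : 1 - n%:R * (1 - y / x) <= (y / x) `^ s.
  have [->|tn0] := eqVneq (y / x) 0.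
    rewrite powR0 ?gt_eqF // subr0 mulr1 subr_le0 /n ler1n //.
  apply: le_trans (_ : (y / x) `^ n%:R <= _).
    by rewrite powR_mulrn // bernoulli_le // t0.
  by apply: ger_powR; rewrite ?lt_neqAle ?(eq_sym 0) ?tn0 ?t0 ?t1 ?andbT //= ltW// truncnS_gt.
have X0 := powR_ge0 x s.
have : x `^ s * (1 - n%:R * (1 - y / x)) <= x `^ s * (y / x) `^ s by rewrite ler_wpM2l.
have -> : n%:R * (x - y) / x = n%:R * (1 - y / x) by field.
nra.
Qed.

(** The natural number comes from [powR_sub_le], the power of 2 from comparing x with twice the
    larger of y and z, and the factor 2 from x^s + y^s <= 2 x^s. *)
Definition kernel_const s : R := 2 * (Num.truncn s).+1%:R * 2 `^ s.

Lemma kernel_le s x y z : 0 < s -> 0 <= y -> 0 <= z -> y <= x -> x <= y + z ->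
  (x `^ (2 * s) - y `^ (2 * s)) * y <=
  kernel_const s * (x `^ s * y `^ s * z + x `^ s * z `^ s * y).
Proof.
move=> s0 y0 z0 yx xyz; rewrite /kernel_const.
have E t : t `^ (2 * s) = (t `^ s) ^+ 2.
  by rewrite mulrC powRrM powR_mulrn // powR_ge0.
rewrite !E; set n := (Num.truncn s).+1.
have [X0 Y0 Z0 K0] := And4 (powR_ge0 x s) (powR_ge0 y s) (powR_ge0 z s) (powR_ge0 2 s).
have n1 : (1 : R) <= n%:R by rewrite ler1n.
have [x_le0|x0] := leP x 0.
  have -> : y = 0 by lra.
  by rewrite mulr0 !mulr_ge0 ?addr_ge0 ?mulr_ge0 // powR_ge0.
have [zy|yz] := leP z y.
  have XY : x `^ s <= 2 `^ s * y `^ s.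
    rewrite -powRM //; apply: ge0_ler_powR; rewrite ?nnegrE; lra.
  have := powR_sub_le s x y s0 y0 yx x0; rewrite -/n => D.
  have YX : y `^ s <= x `^ s.
    by apply: ge0_ler_powR; rewrite ?nnegrE; lra.
  have D2 : (x `^ s - y `^ s) * y <= n%:R * z * x `^ s.
    apply: le_trans (_ : n%:R * (x - y) / x * x `^ s * y <= _).
      by rewrite ler_wpM2r.
    have -> : n%:R * (x - y) / x * x `^ s * y = n%:R * (y / x) * ((x - y) * x `^ s).
      by field; rewrite gt_eqF.
    have t1 : y / x <= 1 by rewrite ler_pdivrMr // mul1r.
    have t0 : 0 <= y / x by rewrite divr_ge0 // ltW.
    have A : (x - y) * x `^ s <= z * x `^ s by rewrite ler_wpM2r //; lra.
    rewrite -[n%:R * z * _]mulrA; apply: ler_pM => //.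
    - by rewrite mulr_ge0.
    - by rewrite mulr_ge0 //; lra.
    - by rewrite ler_piMr.
  rewrite subr_sqr mulrAC.
  apply: le_trans (_ : (n%:R * z * x `^ s) * (2 * x `^ s) <= _).
    by apply: ler_pM => //; [apply: mulr_ge0 => //; lra | lra | lra].
  rewrite -subr_ge0 mulrDr -addrA.
  set P := n%:R * z * x `^ s.
  have P0 : 0 <= P by rewrite /P !mulr_ge0.
  have -> : 2 * n%:R * 2 `^ s * (x `^ s * y `^ s * z) = 2 * P * (2 `^ s * y `^ s).
    by rewrite /P; ring.
  have : 0 <= 2 * n%:R * 2 `^ s * (x `^ s * z `^ s * y) by rewrite !mulr_ge0.
  have : 2 * P * x `^ s <= 2 * P * (2 `^ s * y `^ s) by rewrite ler_wpM2l // mulr_ge0.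
  lra.
have XZ : x `^ s <= 2 `^ s * z `^ s.
  rewrite -powRM //; apply: ge0_ler_powR; rewrite ?nnegrE; lra.
have A : x `^ s * y * x `^ s <= x `^ s * y * (2 `^ s * z `^ s).
  by rewrite ler_wpM2l // mulr_ge0.
have B : 0 <= 2 * n%:R * 2 `^ s * (x `^ s * y `^ s * z) by rewrite !mulr_ge0.
have C : 0 <= y `^ s ^+ 2 * y by rewrite mulr_ge0 ?sqr_ge0.
have D : 0 <= 2 `^ s * (x `^ s * z `^ s * y) by rewrite !mulr_ge0.
have F : 0 <= (2 * n%:R - 1) * (2 `^ s * (x `^ s * z `^ s * y)).
  by rewrite mulr_ge0 //; lra.
nra.
Qed.

(* [1 + v <= expR v] at [v = d (ln n.+1 - ln n)], with [ln t <= t - 1]. *)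
Lemma powR_telescope_le (d : R) (n : nat) : 0 < d -> (0 < n)%N ->
  d * n.+1%:R `^ (- (1 + d)) <= n%:R `^ (- d) - n.+1%:R `^ (- d).
Proof.
move=> d0 n0.
have n0R : (0 : R) < n%:R by rewrite ltr0n.
have m0R : (0 : R) < n.+1%:R by rewrite ltr0n.
have -> : n.+1%:R `^ (- (1 + d)) = n.+1%:R `^ (- d) / n.+1%:R.
  rewrite opprD powRD; last by rewrite (gt_eqF m0R) implybT.
  by rewrite powR_inv1 1?mulrC // ltW.
have L : ln (n%:R / n.+1%:R : R) <= - n.+1%:R^-1.
  have -> : (n%:R / n.+1%:R : R) = 1 + (- n.+1%:R^-1).
    by rewrite -natr1; field; rewrite natr1 gt_eqF.
  apply: le_ln1Dx; rewrite ltrN2 invf_lt1 // ltr1n //.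
have -> : n%:R `^ (- d) = n.+1%:R `^ (- d) * (n%:R / n.+1%:R) `^ (- d).
  rewrite -powRM ?ltW ?divr_gt0 //; congr (_ `^ _); field; by rewrite gt_eqF.
have E : 1 + d / n.+1%:R <= (n%:R / n.+1%:R) `^ (- d).
  rewrite /powR gt_eqF ?divr_gt0 //; apply: le_trans (expR_ge1Dx _).
  by rewrite lerD2l mulNr -mulrN ler_pM2l // lerNr.
have := powR_gt0 (- d) m0R.
set P := n.+1%:R `^ _ => P0.
have -> : d * (P / n.+1%:R) = P * (d / n.+1%:R) by ring.
by rewrite lerBrDl -{1}[P]mulr1 -mulrDr ler_pM2l.
Qed.

End RealInequalities.

(** * Comparison of finite sums and the Cauchy-Schwarz inequality *)

Section FiniteSums.
Context {R : realType} {I : eqType}.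
Implicit Types (r : seq I) (f g : I -> R).

(** Meant for translates of the box of modes, which overlap the box only in part: whatever falls
    outside must carry a zero term. *)
Lemma ler_sum_uniq_support (r1 r2 : seq I) f :
  uniq r1 -> uniq r2 -> (forall i, 0 <= f i) ->
  (forall i, i \in r1 -> f i != 0 -> i \in r2) ->
  \sum_(i <- r1) f i <= \sum_(i <- r2) f i.
Proof.
move=> u1 u2 f0 sub.
have step : \sum_(i <- r1) f i <= \sum_(i <- r2 | i \in r1) f i.
  rewrite (bigID (fun i => i \in r2)) /= [X in _ + X]big1_seq ?addr0; last first.
    by move=> i /andP[ir2 ir1]; apply/eqP; apply: contraNT ir2 => /(sub _ ir1).
  rewrite -big_filter -[leRHS]big_filter.
  rewrite (perm_big [seq i <- r2 | i \in r1]) //.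
  by apply: uniq_perm; rewrite ?filter_uniq // => i; rewrite !mem_filter andbC.
by apply: (le_trans step); rewrite [leRHS](bigID (mem r1)) /= lerDl sumr_ge0.
Qed.

(** Weighted AM-GM termwise, with weight (b + e) / (a + e) where a and b are the two square roots.
    The regularisation e > 0 avoids treating a = 0 or b = 0 apart, and is then removed by letting e
    tend to 0. *)
Lemma sum_cauchy_schwarz r f g :
  \sum_(i <- r) f i * g i <=
  Num.sqrt (\sum_(i <- r) f i ^+ 2) * Num.sqrt (\sum_(i <- r) g i ^+ 2).
Proof.
set A := \sum_(i <- r) f i ^+ 2; set B := \sum_(i <- r) g i ^+ 2.
have A0 : 0 <= A by apply: sumr_ge0 => i _; exact: sqr_ge0.
have B0 : 0 <= B by apply: sumr_ge0 => i _; exact: sqr_ge0.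
have sqrtA := sqr_sqrtr A0; have sqrtB := sqr_sqrtr B0.
set a := Num.sqrt A in sqrtA *; set b := Num.sqrt B in sqrtB *.
have a0 : 0 <= a by exact: sqrtr_ge0.
have b0 : 0 <= b by exact: sqrtr_ge0.
have amgm (e : R) : 0 < e ->
    \sum_(i <- r) f i * g i <= (A / (a + e) * (b + e) + B / (b + e) * (a + e)) / 2.
  move=> e0.
  have ae : 0 < a + e by rewrite ltr_wpDl.
  have be : 0 < b + e by rewrite ltr_wpDl.
  apply: le_trans (_ : \sum_(i <- r) (f i ^+ 2 / (a + e) * (b + e) + g i ^+ 2 / (b + e) * (a + e)) / 2 <= _).
    apply: ler_sum => i _.
    rewrite -subr_ge0.
    have -> : (f i ^+ 2 / (a + e) * (b + e) + g i ^+ 2 / (b + e) * (a + e)) / 2 - f i * g i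
       = (f i * (b + e) - g i * (a + e)) ^+ 2 / (2 * (a + e) * (b + e)).
      by field; rewrite !gt_eqF.
    by rewrite divr_ge0 ?sqr_ge0 // !mulr_ge0 // ltW.
  by rewrite -mulr_suml big_split /= -!mulr_suml.
apply/ler_addgt0Pl => d d0.
have [e e0 He] : exists2 e, 0 < e & (a + e) * (b + e) <= d + a * b.
  have ab1 : 0 < a + b + 1 by lra.
  (* The excess (a + e) (b + e) - a b = e (a + b + e) is at most e (a + b + 1) once e <= 1. *)
  exists (Num.min 1 (d / (a + b + 1))); first by rewrite lt_min ltr01 divr_gt0.
  set e := Num.min _ _.
  have e1 : e <= 1 by rewrite ge_min lexx.
  have e2 : e * (a + b + 1) <= d by rewrite -ler_pdivlMr // ge_min lexx orbT.
  have e0 : 0 <= e by rewrite le_min ler01 divr_ge0 // ltW.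
  have : e * e <= e * 1 by rewrite ler_wpM2l.
  nra.
apply: le_trans (amgm e e0) _; apply: le_trans He.
have ae : 0 < a + e by rewrite ltr_wpDl.
have be : 0 < b + e by rewrite ltr_wpDl.
have : A / (a + e) <= a + e.
  by rewrite ler_pdivrMr // -sqrtA; nra.
have : B / (b + e) <= b + e.
  by rewrite ler_pdivrMr // -sqrtB; nra.
move=> H1 H2.
have : A / (a + e) * (b + e) <= (a + e) * (b + e) by rewrite ler_pM2r.
have : B / (b + e) * (a + e) <= (b + e) * (a + e) by rewrite ler_pM2r.
lra.
Qed.

End FiniteSums.

(** * Weighted sums over the Fourier modes *)

Section Lattice.
Context {R : realType}.
Implicit Types (k l m : int * int) (N : nat) (s : R).

(** One-dimensional factor of a product majorant on the lattice, so that sums over the square box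
    factor into sums over lines. The maximum gives weight 1 to j = 0. *)
Definition line_weight (d : R) (j : int) : R := Num.max 1 `|j|%:~R `^ (- (1 + d)).

Lemma sum_line_weight_le (d : R) N : 0 < d ->
  \sum_(i <- iota 0 (2 * N).+1) line_weight d (i%:Z - N%:Z) <= 3 + 2 / d.
Proof.
move=> d0; have d20 : 0 < 2 / d by rewrite divr_gt0.
have S0 : \sum_(i <- iota 0 1) line_weight d (i%:Z - 0%:Z) = 1.
  by rewrite big_seq1 /line_weight normr0 max_l ?powR1 // ler01.
have lwN (j : int) : line_weight d (- j) = line_weight d j by rewrite /line_weight normrN.
have lwn n : line_weight d n.+1%:Z = n.+1%:R `^ (- (1 + d)).
  by rewrite /line_weight max_r // ler1z.
have step n : \sum_(i <- iota 0 (2 * n.+1).+1) line_weight d (i%:Z - n.+1%:Z) =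
    \sum_(i <- iota 0 (2 * n).+1) line_weight d (i%:Z - n%:Z) + 2 * n.+1%:R `^ (- (1 + d)).
  have -> : (2 * n.+1).+1 = (1 + ((2 * n).+1 + 1))%N by lia.
  rewrite !iotaD !big_cat !big_seq1 add0n.
  rewrite sub0r lwN lwn.
  have -> : ((1 + (2 * n).+1)%N%:Z - n.+1%:Z = n.+1%:Z) by lia.
  rewrite lwn (iotaDl 1 0) big_map.
  under eq_bigr => i _.
    have -> : ((1 + i)%N%:Z - n.+1%:Z = i%:Z - n%:Z) by lia.
    over.
  by rewrite /=; ring.
(* The entries 0 and 1, -1 account for the 3. The others telescope to 2 / d, and the subtracted
   power is the part of this budget still unspent, without which the induction would not close. *)
have bound n : \sum_(i <- iota 0 (2 * n.+1).+1) line_weight d (i%:Z - n.+1%:Z) <=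
    3 + 2 / d * (1 - n.+1%:R `^ (- d)).
  elim: n => [|n IH]; first by rewrite step S0 !powR1; lra.
  rewrite step.
  have := powR_telescope_le d n.+1 d0 isT.
  set p := n.+2%:R `^ _; set q := n.+2%:R `^ _; set t := n.+1%:R `^ _ in IH * => H.
  have : 2 / d * (d * p) <= 2 / d * (t - q) by rewrite ler_pM2l.
  have -> : 2 / d * (d * p) = 2 * p by field; rewrite gt_eqF.
  lra.
case: N => [|n]; first by rewrite S0; lra.
by apply: le_trans (bound n) _; rewrite lerD2l ler_piMr ?(ltW d20).
Qed.

Lemma sum_modes_line_weight_le (d : R) N : 0 < d ->
  \sum_(k <- modes N) line_weight d k.1 * line_weight d k.2 <= (3 + 2 / d) ^+ 2.
Proof.
move=> d0; rewrite /modes big_allpairs_dep /=.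
under eq_bigr do rewrite -mulr_sumr.
rewrite -mulr_suml -expr2 lerXn2r ?nnegrE ?sum_line_weight_le //.
  by apply: sumr_ge0 => i _; exact: powR_ge0.
by rewrite addr_ge0 ?divr_ge0 // ltW.
Qed.

Lemma normk_ge0 k : 0 <= normk k :> R. Proof. exact: sqrtr_ge0. Qed.

Lemma normk0 : normk 0 = 0 :> R.
Proof. by rewrite /normk /= expr0n addr0 sqrtr0. Qed.

Lemma normkN k : normk (- k) = normk k :> R.
Proof. by rewrite /normk /= !mulrNz !sqrrN. Qed.

Lemma sqr_normk k : normk k ^+ 2 = k.1%:~R ^+ 2 + k.2%:~R ^+ 2 :> R.
Proof. by rewrite sqr_sqrtr // addr_ge0 ?sqr_ge0. Qed.

Lemma le_normkD k l : normk (k + l) <= normk k + normk l :> R.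
Proof.
have := le_normcD (Complex (k.1%:~R) (k.2%:~R) : R[i]) (Complex (l.1%:~R) (l.2%:~R)).
by rewrite /= -!intrD.
Qed.

Lemma ler_fst_normk k : `|k.1%:~R| <= normk k :> R.
Proof. by rewrite -sqrtr_sqr ler_wsqrtr // lerDl sqr_ge0. Qed.

Lemma ler_snd_normk k : `|k.2%:~R| <= normk k :> R.
Proof. by rewrite -sqrtr_sqr ler_wsqrtr // lerDr sqr_ge0. Qed.

Lemma normk_ge1 k : k != 0 -> 1 <= normk k :> R.
Proof.
move=> k0; have [k1|k1] := eqVneq k.1 0.
  have k2 : k.2 != 0 by move: k0; case: k k1 => a b /= ->; apply: contra => /eqP ->.
  apply: le_trans (ler_snd_normk k); rewrite -intr_norm ler1z; lia.
apply: le_trans (ler_fst_normk k); rewrite -intr_norm ler1z; lia.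
Qed.

(** Both maxima are at most |k|, since |k| >= 1, and the exponent 1 - s is negative. Writing 1 - s =
    -(1 + (s - 2)) shows where s > 2 enters: it makes each line weight summable. *)
Lemma normk_powR_line_weight_le s k : 2 < s -> k != 0 ->
  (normk k `^ (1 - s)) ^+ 2 <= line_weight (s - 2) k.1 * line_weight (s - 2) k.2.
Proof.
move=> s2 k0; have k1 := normk_ge1 k k0.
have n0 : 0 <= normk k :> R by exact: normk_ge0.
rewrite /line_weight -powRM ?le_max ?ler01 //.
have -> : - (1 + (s - 2)) = 1 - s by ring.
rewrite expr2 -powRM //.
set x := Num.max _ _; set y := Num.max _ _.
have x1 : 1 <= x by rewrite le_max lexx.
have y1 : 1 <= y by rewrite le_max lexx.
have xk : x <= normk k by rewrite ge_max k1 intr_norm ler_fst_normk.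
have yk : y <= normk k by rewrite ge_max k1 intr_norm ler_snd_normk.
have xy0 : 0 < x * y by rewrite mulr_gt0 // (lt_le_trans ltr01).
have -> : 1 - s = - (s - 1) by ring.
rewrite !powRN lef_pV2 ?posrE ?powR_gt0 //; last by rewrite mulr_gt0 // (lt_le_trans ltr01).
apply: ge0_ler_powR; rewrite ?nnegrE; try lra.
  by rewrite mulr_ge0.
by rewrite ler_pM //; lra.
Qed.

Definition sobolev_weight s k : R := 1 + normk k `^ (2 * s).

Lemma sobolev_weightE s k : sobolev_weight s k = 1 + (normk k `^ s) ^+ 2.
Proof. by rewrite /sobolev_weight mulrC powRrM powR_mulrn // powR_ge0. Qed.

Lemma sobolev_weight_gt0 s k : 0 < sobolev_weight s k.
Proof. by rewrite ltr_pwDl ?powR_ge0. Qed.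

Definition wnorm N (w : int * int -> R) (a : int * int -> R) : R :=
  Num.sqrt (\sum_(k <- modes N) w k * a k ^+ 2).

Lemma wnorm_ge0 N w a : 0 <= wnorm N w a. Proof. exact: sqrtr_ge0. Qed.

Lemma sqr_wnorm N w a : (forall k, 0 <= w k) ->
  wnorm N w a ^+ 2 = \sum_(k <- modes N) w k * a k ^+ 2.
Proof.
move=> w0; rewrite sqr_sqrtr //.
by apply: sumr_ge0 => k _; rewrite mulr_ge0 ?sqr_ge0.
Qed.

Lemma sqrt_sum_le_wnorm N s (a : int * int -> R) :
  Num.sqrt (\sum_(k <- modes N) (normk k `^ s * a k) ^+ 2) <= wnorm N (sobolev_weight s) a.
Proof.
rewrite ler_wsqrtr //; apply: ler_sum => k _.
by rewrite exprMn sobolev_weightE ler_wpM2r ?sqr_ge0 // lerDr.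
Qed.

(** The discrete form of the embedding of H^s into Lipschitz functions: Cauchy-Schwarz on |k| =
    |k|^{1-s} |k|^s, the first factor being square summable. The mode 0 has no derivative to
    control, so [q] vanishes there. *)
Lemma sum_normk_le s N (a : int * int -> R) : 2 < s -> (forall k, 0 <= a k) ->
  \sum_(k <- modes N) normk k * a k <= (3 + 2 / (s - 2)) * wnorm N (sobolev_weight s) a.
Proof.
move=> s2 a0; pose q k : R := if k == 0 then 0 else normk k `^ (1 - s).
rewrite (eq_bigr (fun k => q k * (normk k `^ s * a k))); last first.
  move=> k _; rewrite /q; have [->|k0] := eqVneq k 0; first by rewrite normk0 !mul0r.
  rewrite mulrA -powRD; last first.
    by rewrite (gt_eqF (lt_le_trans ltr01 (normk_ge1 k k0))) implybT.
  by rewrite subrK powRr1 // normk_ge0.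
apply: le_trans (sum_cauchy_schwarz _ _ _) _.
have d0 : 0 < s - 2 by lra.
have c0 : 0 <= 3 + 2 / (s - 2) by rewrite addr_ge0 // divr_ge0 // ltW.
apply: ler_pM; rewrite ?sqrtr_ge0 ?sqrt_sum_le_wnorm //.
rewrite -[leRHS]ger0_norm // -sqrtr_sqr ler_wsqrtr //.
apply: le_trans (sum_modes_line_weight_le (s - 2) N d0).
apply: ler_sum => k _; rewrite /q; have [->|k0] := eqVneq k 0.
  by rewrite expr0n mulr_ge0 // powR_ge0.
exact: normk_powR_line_weight_le.
Qed.

(** The constant 1 in the weights cancels, and [kernel_le] applies with |k| <= |m| + |k - m|. It
    yields the first two terms when |m| <= |k|; the third is their mirror image, added so that the
    bound is symmetric in (k, m). *)
Lemma kernel_normk_le s k m : 0 < s ->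
  `|sobolev_weight s k - sobolev_weight s m| * Num.min (normk k) (normk m) <=
  kernel_const s * (normk k `^ s * normk m `^ s * normk (k - m) +
                    normk k `^ s * normk (k - m) `^ s * normk m +
                    normk m `^ s * normk (k - m) `^ s * normk k).
Proof.
move=> s0; wlog km : k m / normk m <= normk k :> R => [H|].
  have /orP[/H//|/H h] := le_total (normk m : R) (normk k).
  rewrite distrC minC -(opprB m k) normkN; apply: le_trans h _.
  by rewrite [normk k `^ s * normk m `^ s]mulrC addrAC.
have C0 : 0 <= kernel_const s by rewrite /kernel_const !mulr_ge0 // powR_ge0.
rewrite (min_r km) ger0_norm; last first.
  rewrite subr_ge0 /sobolev_weight lerD2l.
  by apply: ge0_ler_powR; rewrite ?nnegrE ?normk_ge0 // mulr_ge0 // ltW.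
rewrite /sobolev_weight opprD addrACA subrr add0r.
have T : normk k <= normk m + normk (k - m) :> R.
  by have := le_normkD m (k - m); rewrite [m + _]addrC subrK.
apply: le_trans (kernel_le s _ _ _ s0 (normk_ge0 m) (normk_ge0 (k - m)) km T) _.
rewrite ler_wpM2l // lerDl !mulr_ge0 ?powR_ge0 ?normk_ge0 //.
Qed.

Lemma modesN N k : (- k \in modes N) = (k \in modes N).
Proof. by rewrite !mem_modes /=; lia. Qed.

(** The shift may push k - m out of the box, where f vanishes. This version sums over m, the primed
    one over k, because the trilinear estimate freezes either index. *)
Lemma sum_shift_le N (f : int * int -> R) k : (forall l, 0 <= f l) ->
  (forall l, l \notin modes N -> f l = 0) ->
  \sum_(m <- modes N) f (k - m) <= \sum_(l <- modes N) f l.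
Proof.
move=> f0 supp; rewrite -(big_map (fun m => k - m) xpredT f).
apply: ler_sum_uniq_support => //.
- by rewrite map_inj_uniq ?modes_uniq // => x y /addrI/oppr_inj.
- exact: modes_uniq.
by move=> l _; apply: contraR => /supp ->.
Qed.

Lemma sum_shift_le' N (f : int * int -> R) m : (forall l, 0 <= f l) ->
  (forall l, l \notin modes N -> f l = 0) ->
  \sum_(k <- modes N) f (k - m) <= \sum_(l <- modes N) f l.
Proof.
move=> f0 supp; rewrite -(big_map (fun k => k - m) xpredT f).
apply: ler_sum_uniq_support => //.
- by rewrite map_inj_uniq ?modes_uniq // => x y /addIr.
- exact: modes_uniq.
by move=> l _; apply: contraR => /supp ->.
Qed.

(* The three terms of [kernel_normk_le] put one derivative on [a], on the
   second and on the first copy of [b]; the factor carrying it is summable in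
   l^1 by [sum_normk_le], the other two are in l^2. *)
Lemma trilinear_le s N (a b : int * int -> R) : 2 < s ->
  (forall k, 0 <= a k) -> (forall k, 0 <= b k) ->
  (forall k, k \notin modes N -> a k = 0) ->
  \sum_(k <- modes N) \sum_(m <- modes N)
     `|sobolev_weight s k - sobolev_weight s m| * Num.min (normk k) (normk m) *
     (a (k - m) * b m * b k) <=
  3 * kernel_const s * (3 + 2 / (s - 2)) *
    (wnorm N (sobolev_weight s) a * wnorm N (sobolev_weight s) b ^+ 2).
Proof.
move=> s2 a0 b0 supp; have s0 : 0 < s by lra.
have C0 : 0 <= kernel_const s by rewrite /kernel_const !mulr_ge0 // powR_ge0.
set L := 3 + 2 / (s - 2).
have L0 : 0 <= L by rewrite /L addr_ge0 // divr_ge0 //; lra.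
set nA := wnorm N _ a; set nB := wnorm N _ b.
have nA0 : 0 <= nA by exact: wnorm_ge0.
have nB0 : 0 <= nB by exact: wnorm_ge0.
pose A k := normk k `^ s * a k; pose B k := normk k `^ s * b k.
have A0 k : 0 <= A k by rewrite mulr_ge0 ?powR_ge0.
have B0 k : 0 <= B k by rewrite mulr_ge0 ?powR_ge0.
have Bsq : \sum_(k <- modes N) B k ^+ 2 <= nB ^+ 2.
  rewrite sqr_wnorm => [|k]; last by rewrite ltW ?sobolev_weight_gt0.
  apply: ler_sum => k _.
  by rewrite exprMn sobolev_weightE ler_wpM2r ?sqr_ge0 // lerDr.
pose F1 k m := B k * B m * (normk (k - m) * a (k - m)).
pose F2 k m := B k * A (k - m) * (normk m * b m).
pose F3 k m := B m * A (k - m) * (normk k * b k).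
have sF1 : \sum_(k <- modes N) \sum_(m <- modes N) F1 k m <= L * nA * nB ^+ 2.
  pose g l := normk l * a l.
  have g0 l : 0 <= g l by rewrite mulr_ge0 ?normk_ge0.
  have gs l : l \notin modes N -> g l = 0 by move=> /supp ga; rewrite /g ga mulr0.
  have gL : \sum_(l <- modes N) g l <= L * nA by exact: sum_normk_le.
  (* Schur test: 2 B_k B_m <= B_k^2 + B_m^2 decouples the double sum, and in each half the free
     index sees only the summable factor [g]. *)
  apply: le_trans (_ : \sum_(k <- modes N) \sum_(m <- modes N)
      (B k ^+ 2 * g (k - m) + B m ^+ 2 * g (k - m)) / 2 <= _).
    apply: ler_sum => k _; apply: ler_sum => m _; rewrite /F1 -/(g (k - m)).
    have := sqr_ge0 (B k - B m); have := g0 (k - m); nra.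
  under eq_bigr => k _ do rewrite -mulr_suml big_split /= -mulr_sumr.
  rewrite -mulr_suml big_split /= [X in _ + X]exchange_big /=.
  under [X in _ + X]eq_bigr => m _ do rewrite -mulr_sumr.
  have H1 : \sum_(k <- modes N) B k ^+ 2 * (\sum_(m <- modes N) g (k - m)) <= nB ^+ 2 * (L * nA).
    apply: le_trans (_ : \sum_(k <- modes N) B k ^+ 2 * (L * nA) <= _).
      apply: ler_sum => k _; rewrite ler_wpM2l ?sqr_ge0 //.
      exact: le_trans (sum_shift_le _ _ _ _ _) gL.
    by rewrite -mulr_suml ler_wpM2r // mulr_ge0.
  have H2 : \sum_(m <- modes N) B m ^+ 2 * (\sum_(k <- modes N) g (k - m)) <= nB ^+ 2 * (L * nA).
    apply: le_trans (_ : \sum_(k <- modes N) B k ^+ 2 * (L * nA) <= _).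
      apply: ler_sum => k _; rewrite ler_wpM2l ?sqr_ge0 //.
      exact: le_trans (sum_shift_le' _ _ _ _ _) gL.
    by rewrite -mulr_suml ler_wpM2r // mulr_ge0.
  lra.
have As l : l \notin modes N -> A l ^+ 2 = 0.
  by move=> /supp h; rewrite /A h mulr0 expr0n.
have A20 l : 0 <= A l ^+ 2 by exact: sqr_ge0.
have sqrtB : Num.sqrt (\sum_(k <- modes N) B k ^+ 2) <= nB by exact: sqrt_sum_le_wnorm.
have sqrtA : Num.sqrt (\sum_(k <- modes N) A k ^+ 2) <= nA by exact: sqrt_sum_le_wnorm.
have bL : \sum_(m <- modes N) normk m * b m <= L * nB by exact: sum_normk_le.
have sF2 : \sum_(k <- modes N) \sum_(m <- modes N) F2 k m <= L * nA * nB ^+ 2.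
  (* The summable factor is indexed by m here, so m becomes the outer index and Cauchy-Schwarz is
     applied in k. *)
  rewrite exchange_big /=.
  apply: le_trans (_ : \sum_(m <- modes N) (nB * nA) * (normk m * b m) <= _).
    apply: ler_sum => m _; rewrite -mulr_suml ler_wpM2r ?mulr_ge0 ?normk_ge0 //.
    apply: le_trans (sum_cauchy_schwarz _ _ _) _.
    apply: ler_pM; rewrite ?sqrtr_ge0 //; apply: le_trans sqrtA.
    by rewrite ler_wsqrtr // (sum_shift_le' N (fun l => A l ^+ 2)).
  rewrite -mulr_sumr.
  have : nB * nA * (\sum_(m <- modes N) normk m * b m) <= nB * nA * (L * nB).
    by rewrite ler_wpM2l // mulr_ge0.
  by move=> /le_trans; apply; apply: le_of_eq; ring.
have sF3 : \sum_(k <- modes N) \sum_(m <- modes N) F3 k m <= L * nA * nB ^+ 2.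
  apply: le_trans (_ : \sum_(k <- modes N) (nB * nA) * (normk k * b k) <= _).
    apply: ler_sum => k _; rewrite -mulr_suml ler_wpM2r ?mulr_ge0 ?normk_ge0 //.
    apply: le_trans (sum_cauchy_schwarz _ _ _) _.
    apply: ler_pM; rewrite ?sqrtr_ge0 //; apply: le_trans sqrtA.
    by rewrite ler_wsqrtr // (sum_shift_le N (fun l => A l ^+ 2)).
  rewrite -mulr_sumr.
  have : nB * nA * (\sum_(m <- modes N) normk m * b m) <= nB * nA * (L * nB).
    by rewrite ler_wpM2l // mulr_ge0.
  by move=> /le_trans; apply; apply: le_of_eq; ring.
apply: le_trans (_ : \sum_(k <- modes N) \sum_(m <- modes N)
    kernel_const s * (F1 k m + F2 k m + F3 k m) <= _).
  apply: ler_sum => k _; apply: ler_sum => m _.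
  have ab0 : 0 <= a (k - m) * b m * b k by rewrite !mulr_ge0.
  apply: le_trans (ler_wpM2r ab0 (kernel_normk_le s k m s0)) _.
  by apply: le_of_eq; rewrite /F1 /F2 /F3 /A /B; ring.
under eq_bigr => k _ do rewrite -mulr_sumr !big_split /=.
rewrite -mulr_sumr !big_split /=.
have -> : 3 * kernel_const s * L * (nA * nB ^+ 2) =
  kernel_const s * (L * nA * nB ^+ 2 + L * nA * nB ^+ 2 + L * nA * nB ^+ 2) by ring.
by rewrite ler_wpM2l // lerD // lerD.
Qed.

End Lattice.

(** * Energy inequality in Fourier coefficients *)

Section ComplexParts.
Context {R : realType}.
Implicit Types (z : R[i]) (x y : R).
Import complex.

Lemma Re_add z1 z2 : Re (z1 + z2) = Re z1 + Re z2.
Proof. by case: z1; case: z2. Qed.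

Lemma Re_sum (I : Type) (r : seq I) (f : I -> R[i]) :
  Re (\sum_(i <- r) f i) = \sum_(i <- r) Re (f i).
Proof. by rewrite (big_morph _ Re_add (erefl (Re (0 : R[i])))). Qed.

Lemma Re_realM x z : Re (real_complex R x * z) = x * Re z.
Proof. by case: z => a b /=; rewrite mul0r subr0. Qed.

Lemma Re_mul_conj z : Re (z * conjc z) = Normc.normc z ^+ 2.
Proof.
case: z => a b /=; rewrite sqr_sqrtr ?addr_ge0 ?sqr_ge0 //.
by rewrite mulrN opprK !expr2.
Qed.

Lemma normc_ge0 z : 0 <= Normc.normc z.
Proof. by case: z => a b; exact: sqrtr_ge0. Qed.

Lemma ler_Re_normc z : `|Re z| <= Normc.normc z.
Proof.
case: z => a b /=; rewrite -sqrtr_sqr ler_wsqrtr // lerDl sqr_ge0 //.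
Qed.

Lemma normc_conj z : Normc.normc (conjc z) = Normc.normc z.
Proof. by case: z => a b /=; rewrite sqrrN. Qed.

Lemma normc_int (n : int) : Normc.normc (n%:~R : R[i]) = `|n%:~R|.
Proof.
rewrite -(rmorph_int (real_complex R)) /= expr0n addr0 sqrtr_sqr //.
Qed.

Lemma normc_i : Normc.normc ('i%C : R[i]) = 1.
Proof. by rewrite /= expr0n expr1n add0r sqrtr1. Qed.

End ComplexParts.

Section Energy.
Context {R : realType}.
Import complex.
Implicit Types (k m : int * int) (N : nat) (a b : int * int -> R[i]).

Definition cdot k (z1 z2 : R[i]) : R[i] := k.1%:~R * z1 + k.2%:~R * z2.

Definition amp a1 a2 k : R := Num.sqrt (Normc.normc (a1 k) ^+ 2 + Normc.normc (a2 k) ^+ 2).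

Lemma sqr_amp a1 a2 k :
  amp a1 a2 k ^+ 2 = Normc.normc (a1 k) ^+ 2 + Normc.normc (a2 k) ^+ 2.
Proof. by rewrite sqr_sqrtr // addr_ge0 ?sqr_ge0. Qed.

Lemma normc_le_amp a1 a2 k : Normc.normc (a1 k) <= amp a1 a2 k /\ Normc.normc (a2 k) <= amp a1 a2 k.
Proof.
by split; rewrite -[leLHS]ger0_norm ?normc_ge0 // -sqrtr_sqr ler_wsqrtr // ?lerDl ?lerDr sqr_ge0.
Qed.

Lemma normc_cdot_le k a1 a2 l : Normc.normc (cdot k (a1 l) (a2 l)) <= 2 * (normk k * amp a1 a2 l).
Proof.
have [h1 h2] := normc_le_amp a1 a2 l.
apply: le_trans (le_normcD _ _) _; rewrite !Normc.normcM !normc_int.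
have := ler_pM (normr_ge0 _) (normc_ge0 _) (ler_fst_normk k) h1.
have := ler_pM (normr_ge0 _) (normc_ge0 _) (ler_snd_normk k) h2.
lra.
Qed.

Definition transfer a1 a2 b1 b2 k m : R :=
  Re ('i%C * cdot m (a1 (k - m)) (a2 (k - m)) *
      (b1 m * conjc (b1 k) + b2 m * conjc (b2 k))).

Section Transfer.
Context {a1 a2 : int * int -> R[i]}.
Hypotheses (a1J : forall k, a1 (- k) = conjc (a1 k))
  (a2J : forall k, a2 (- k) = conjc (a2 k))
  (adiv : forall k, cdot k (a1 k) (a2 k) = 0).

(** The vector a(k - m) is orthogonal to its own frequency k - m. Both the antisymmetry of
    [transfer] and the minimum in [transfer_le] rest on this. *)
Lemma cdot_shift k m : cdot m (a1 (k - m)) (a2 (k - m)) = cdot k (a1 (k - m)) (a2 (k - m)).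
Proof.
apply/eqP; rewrite eq_sym -subr_eq0 -(adiv (k - m)) /cdot /= !rmorphB /=.
by apply/eqP; ring.
Qed.

(** By [a1J] and [a2J], which express that the advecting field is real, exchanging k and m
    conjugates the advecting factor as well as the product of the b's; and the real part of i times
    conj(z) is minus that of i z. *)
Lemma transfer_antisym b1 b2 k m :
  transfer a1 a2 b1 b2 m k = - transfer a1 a2 b1 b2 k m.
Proof.
rewrite /transfer (cdot_shift k m) -(opprB k m) a1J a2J.
have -> : cdot k (conjc (a1 (k - m))) (conjc (a2 (k - m))) =
    conjc (cdot k (a1 (k - m)) (a2 (k - m))).
  by rewrite /cdot rmorphD !rmorphM /= !rmorph_int.
have -> : b1 k * conjc (b1 m) + b2 k * conjc (b2 m) =
    conjc (b1 m * conjc (b1 k) + b2 m * conjc (b2 k)).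
  by rewrite rmorphD !rmorphM /= !conjcK mulrC [b2 k * _]mulrC.
case: (cdot _ _ _) => p q; case: (_ + _) => u v; rewrite /=; ring.
Qed.

(** The advecting factor is estimated as it stands, giving |m|, or after [cdot_shift], giving |k|,
    whichever is smaller. *)
Lemma transfer_le b1 b2 k m :
  `|transfer a1 a2 b1 b2 k m| <= 4 * (Num.min (normk k) (normk m) *
     (amp a1 a2 (k - m) * amp b1 b2 m * amp b1 b2 k)).
Proof.
apply: le_trans (ler_Re_normc _) _; rewrite !Normc.normcM normc_i mul1r.
have H1 : Normc.normc (cdot m (a1 (k - m)) (a2 (k - m))) <=
    2 * (Num.min (normk k) (normk m) * amp a1 a2 (k - m)).
  rewrite minElt; case: ifP => _; last exact: normc_cdot_le.
  rewrite cdot_shift; exact: normc_cdot_le.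
have H2 : Normc.normc (b1 m * conjc (b1 k) + b2 m * conjc (b2 k)) <=
    2 * (amp b1 b2 m * amp b1 b2 k).
  have [h1 h2] := normc_le_amp b1 b2 k; have [h3 h4] := normc_le_amp b1 b2 m.
  apply: le_trans (le_normcD _ _) _; rewrite !Normc.normcM !normc_conj.
  have := ler_pM (normc_ge0 _) (normc_ge0 _) h3 h1.
  have := ler_pM (normc_ge0 _) (normc_ge0 _) h4 h2.
  lra.
have := ler_pM (normc_ge0 _) (normc_ge0 _) H1 H2.
move=> /le_trans; apply.
by apply: le_of_eq; ring.
Qed.

(* Symmetrising in (k, m) gains the difference of the weights. *)
Lemma sum_transfer N (w : int * int -> R) b1 b2 :
  \sum_(k <- modes N) w k * \sum_(m <- modes N) transfer a1 a2 b1 b2 k m =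
  2^-1 * \sum_(k <- modes N) \sum_(m <- modes N)
     (w k - w m) * transfer a1 a2 b1 b2 k m.
Proof.
pose S := \sum_(k <- modes N) \sum_(m <- modes N) w k * transfer a1 a2 b1 b2 k m.
have E1 : \sum_(k <- modes N) w k * \sum_(m <- modes N) transfer a1 a2 b1 b2 k m = S.
  by apply: eq_bigr => k _; rewrite mulr_sumr.
have E2 : \sum_(k <- modes N) \sum_(m <- modes N) w m * transfer a1 a2 b1 b2 k m = - S.
  rewrite exchange_big /= -sumrN; apply: eq_bigr => k _.
  rewrite -sumrN; apply: eq_bigr => m _.
  by rewrite (transfer_antisym _ _ k m) mulrN.
have -> : \sum_(k <- modes N) \sum_(m <- modes N) (w k - w m) * transfer a1 a2 b1 b2 k m = S - - S.
  rewrite -E2 -sumrB; apply: eq_bigr => k _; rewrite -sumrB; apply: eq_bigr => m _.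
  by rewrite mulrBl.
rewrite E1; lra.
Qed.

(** Here a is the old field, b the new one, and [q] the pressure coefficients, about which nothing
    is assumed since they only multiply k . conj(b(k)) = 0. The identity is established mode by
    mode, so any nonnegative weight can be applied before summing; the factor 1/2 is that of
    [sum_transfer], after which signs are given up. *)
Lemma energy_le N (tau nu : R) (w : int * int -> R) b1 b2 (q : int * int -> R[i]) :
  0 < tau -> 0 <= nu -> (forall k, 0 <= w k) ->
  (forall k, cdot k (b1 k) (b2 k) = 0) ->
  (forall k, k \in modes N ->
    real_complex R tau^-1 * (b1 k - a1 k)
    + \sum_(m <- modes N) 'i%C * cdot m (a1 (k - m)) (a2 (k - m)) * b1 m
    + 'i%C * k.1%:~R * q k = - real_complex R (nu * normk k ^+ 2) * b1 k) ->
  (forall k, k \in modes N ->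
    real_complex R tau^-1 * (b2 k - a2 k)
    + \sum_(m <- modes N) 'i%C * cdot m (a1 (k - m)) (a2 (k - m)) * b2 m
    + 'i%C * k.2%:~R * q k = - real_complex R (nu * normk k ^+ 2) * b2 k) ->
  \sum_(k <- modes N) w k * amp b1 b2 k ^+ 2 <=
  \sum_(k <- modes N) w k * Re (a1 k * conjc (b1 k) + a2 k * conjc (b2 k))
  + tau / 2 * \sum_(k <- modes N) \sum_(m <- modes N)
     `|w k - w m| * `|transfer a1 a2 b1 b2 k m|.
Proof.
move=> tau0 nu0 w0 bdiv st1 st2.
have H k : k \in modes N -> amp b1 b2 k ^+ 2 <=
    Re (a1 k * conjc (b1 k) + a2 k * conjc (b2 k))
    - tau * \sum_(m <- modes N) transfer a1 a2 b1 b2 k m.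
  move=> kN.
  have div0 : k.1%:~R * conjc (b1 k) + k.2%:~R * conjc (b2 k) = 0.
    by have := congr1 conjc (bdiv k); rewrite conjc0 /cdot rmorphD !rmorphM /= !rmorph_int.
  have E : real_complex R tau^-1 * (b1 k * conjc (b1 k) + b2 k * conjc (b2 k)
        - (a1 k * conjc (b1 k) + a2 k * conjc (b2 k)))
      + \sum_(m <- modes N) 'i%C * cdot m (a1 (k - m)) (a2 (k - m)) *
          (b1 m * conjc (b1 k) + b2 m * conjc (b2 k))
      = real_complex R (- (nu * normk k ^+ 2)) * (b1 k * conjc (b1 k) + b2 k * conjc (b2 k)).
    have := congr2 (fun x y => x * conjc (b1 k) + y * conjc (b2 k)) (st1 k kN) (st2 k kN).
    rewrite rmorphN /=.
    have -> : \sum_(m <- modes N) 'i%C * cdot m (a1 (k - m)) (a2 (k - m)) *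
        (b1 m * conjc (b1 k) + b2 m * conjc (b2 k)) =
      (\sum_(m <- modes N) 'i%C * cdot m (a1 (k - m)) (a2 (k - m)) * b1 m) * conjc (b1 k)
      + (\sum_(m <- modes N) 'i%C * cdot m (a1 (k - m)) (a2 (k - m)) * b2 m) * conjc (b2 k).
      rewrite !mulr_suml -big_split; apply: eq_bigr => m _ /=; ring.
    set S1 := (\sum_(m <- _) _); set S2 := (\sum_(m <- _) _).
    set t := real_complex R tau^-1; set v := real_complex R _.
    have -> : (t * (b1 k - a1 k) + S1 + 'i%C * k.1%:~R * q k) * conjc (b1 k) +
      (t * (b2 k - a2 k) + S2 + 'i%C * k.2%:~R * q k) * conjc (b2 k) =
      t * (b1 k * conjc (b1 k) + b2 k * conjc (b2 k)
        - (a1 k * conjc (b1 k) + a2 k * conjc (b2 k)))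
      + (S1 * conjc (b1 k) + S2 * conjc (b2 k))
      + 'i%C * q k * (k.1%:~R * conjc (b1 k) + k.2%:~R * conjc (b2 k)) by ring.
    rewrite div0 mulr0 addr0 => ->; ring.
  have := congr1 (@Re R) E.
  rewrite Re_add !Re_realM Re_sum -/(transfer _ _ _ _ _).
  have bE : Re (b1 k * conjc (b1 k) + b2 k * conjc (b2 k)) = amp b1 b2 k ^+ 2.
    by rewrite Re_add !Re_mul_conj sqr_amp.
  have -> : Re (b1 k * conjc (b1 k) + b2 k * conjc (b2 k) - (a1 k * conjc (b1 k) + a2 k * conjc (b2 k)))
     = amp b1 b2 k ^+ 2 - Re (a1 k * conjc (b1 k) + a2 k * conjc (b2 k)).
    by rewrite Re_add bE; congr (_ + _); case: (_ + _).
  rewrite bE.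
  have -> : \sum_(m <- modes N) Re ('i%C * cdot m (a1 (k - m)) (a2 (k - m)) *
      (b1 m * conjc (b1 k) + b2 m * conjc (b2 k))) =
    \sum_(m <- modes N) transfer a1 a2 b1 b2 k m by [].
  set S := \sum_(m <- _) _; set P := amp _ _ _ ^+ 2; set Q := Re _ => F.
  have P0 : 0 <= nu * normk k ^+ 2 * P.
    by apply: mulr_ge0; [apply: mulr_ge0 => // |]; exact: sqr_ge0.
  have : tau * (tau^-1 * (P - Q) + S) = tau * (- (nu * normk k ^+ 2) * P) by rewrite F.
  rewrite mulrDr mulrA divff ?gt_eqF // mul1r.
  have : 0 <= tau * (nu * normk k ^+ 2 * P) by rewrite mulr_ge0 // ltW.
  lra.
apply: le_trans (_ : \sum_(k <- modes N) (w k * Re (a1 k * conjc (b1 k) + a2 k * conjc (b2 k))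
    - tau * (w k * \sum_(m <- modes N) transfer a1 a2 b1 b2 k m)) <= _).
  rewrite big_seq [leRHS]big_seq; apply: ler_sum => k kN.
  apply: le_trans (ler_wpM2l (w0 k) (H k kN)) _.
  by rewrite mulrBr mulrCA.
rewrite sumrB lerD2l -mulr_sumr sum_transfer mulrA -mulrN.
have t2 : 0 <= tau / 2 by rewrite divr_ge0 // ltW.
rewrite ler_wpM2l // -sumrN.
apply: ler_sum => k _; rewrite -sumrN; apply: ler_sum => m _.
by rewrite -normrM -[leRHS]normrN ler_norm.
Qed.

End Transfer.

Lemma Re_dot_le a1 a2 b1 b2 k :
  Re (a1 k * conjc (b1 k) + a2 k * conjc (b2 k)) <= amp a1 a2 k * amp b1 b2 k.
Proof.
rewrite /amp -sqrtrM ?addr_ge0 ?sqr_ge0 //.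
apply: le_trans (ler_norm _) _; rewrite -sqrtr_sqr ler_wsqrtr //.
case: (a1 k) => x1 y1; case: (a2 k) => x2 y2; case: (b1 k) => u1 v1; case: (b2 k) => u2 v2 /=.
rewrite !sqr_sqrtr ?addr_ge0 ?sqr_ge0 // -subr_ge0.
set D := (X in 0 <= X).
(* Lagrange identity for two vectors of R^4: the defect in Cauchy-Schwarz is the sum of the six
   squared 2 x 2 minors. *)
have -> : D = (x1 * v1 - y1 * u1) ^+ 2 + (x1 * u2 - x2 * u1) ^+ 2 + (x1 * v2 - y2 * u1) ^+ 2
  + (y1 * u2 - x2 * v1) ^+ 2 + (y1 * v2 - y2 * v1) ^+ 2 + (x2 * v2 - y2 * u2) ^+ 2.
  by rewrite /D; ring.
by rewrite !addr_ge0 ?sqr_ge0.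
Qed.

Lemma sum_Re_dot_le N (w : int * int -> R) a1 a2 b1 b2 : (forall k, 0 <= w k) ->
  \sum_(k <- modes N) w k * Re (a1 k * conjc (b1 k) + a2 k * conjc (b2 k)) <=
  wnorm N w (amp a1 a2) * wnorm N w (amp b1 b2).
Proof.
move=> w0; apply: le_trans (_ : \sum_(k <- modes N)
   (Num.sqrt (w k) * amp a1 a2 k) * (Num.sqrt (w k) * amp b1 b2 k) <= _).
  apply: ler_sum => k _; apply: le_trans (ler_wpM2l (w0 k) (Re_dot_le _ _ _ _ _)) _.
  by rewrite mulrACA -expr2 sqr_sqrtr.
apply: le_trans (sum_cauchy_schwarz _ _ _) _.
by apply: le_of_eq; congr (Num.sqrt _ * Num.sqrt _);
  apply: eq_bigr => k _; rewrite exprMn sqr_sqrtr.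
Qed.

(** The 6 is 1/2 from symmetrisation, times 4 from [transfer_le], times 3 from the three terms of
    the trilinear estimate. *)
Definition growth_const (s : R) : R := 6 * kernel_const s * (3 + 2 / (s - 2)).

Lemma growth_const_gt0 (s : R) : 2 < s -> 0 < growth_const s.
Proof.
move=> s2; have L0 : 0 < s - 2 by lra.
rewrite /growth_const /kernel_const !mulr_gt0 ?powR_gt0 ?ltr0n //.
by rewrite addr_gt0 // divr_gt0.
Qed.

Lemma sum_weighted_transfer_le (s : R) N a1 a2 b1 b2 : 2 < s ->
  (forall k, cdot k (a1 k) (a2 k) = 0) ->
  (forall k, k \notin modes N -> a1 k = 0 /\ a2 k = 0) ->
  2^-1 * \sum_(k <- modes N) \sum_(m <- modes N)
     `|sobolev_weight s k - sobolev_weight s m| * `|transfer a1 a2 b1 b2 k m| <=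
  growth_const s * (wnorm N (sobolev_weight s) (amp a1 a2) *
                    wnorm N (sobolev_weight s) (amp b1 b2) ^+ 2).
Proof.
move=> s2 adiv supp.
have amp0 (c1 c2 : int * int -> R[i]) k : 0 <= amp c1 c2 k by exact: sqrtr_ge0.
have ampS k : k \notin modes N -> amp a1 a2 k = 0.
  by move=> /supp[e1 e2]; rewrite /amp e1 e2 Normc.normc0 expr0n addr0 sqrtr0.
have T := trilinear_le s N _ _ s2 (amp0 a1 a2) (amp0 b1 b2) ampS.
apply: le_trans (_ : 2^-1 * (4 * (3 * kernel_const s * (3 + 2 / (s - 2)) *
    (wnorm N (sobolev_weight s) (amp a1 a2) * wnorm N (sobolev_weight s) (amp b1 b2) ^+ 2))) <= _); last first.
  by apply: le_of_eq; rewrite /growth_const; lra.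
rewrite ler_wpM2l ?invr_ge0 //.
apply: le_trans (ler_wpM2l (ler0n _ 4) T); rewrite mulr_sumr.
apply: ler_sum => k _; rewrite mulr_sumr; apply: ler_sum => m _.
apply: le_trans (ler_wpM2l (normr_ge0 _) (transfer_le adiv b1 b2 k m)) _.
by apply: le_of_eq; ring.
Qed.

End Energy.

(** * The discrete Riccati inequality *)

Section Recursion.
Context {R : realType}.

(** The invariant y_n (1 - c n y_0) <= y_0 is the bound y_0 / (1 - c t y_0) for the equation y' = c
    y^2, written without division. With c M y_0 <= 1/4 it even gives the factor 4/3. *)
Lemma quadratic_growth_le (y : nat -> R) (c : R) (M : nat) :
  (forall n, 0 <= y n) -> 0 <= c -> c * M%:R * y 0%N <= 4^-1 ->
  (forall n, (n < M)%N -> y n.+1 ^+ 2 <= y n * y n.+1 + c * (y n * y n.+1 ^+ 2)) ->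
  forall n, (n <= M)%N -> y n <= 4 * y 0%N.
Proof.
move=> y0 c0 small step.
have cn n : (n <= M)%N -> c * n%:R * y 0%N <= 4^-1.
  move=> nM; apply: le_trans small; rewrite ler_wpM2r // ler_wpM2l // ler_nat //.
have H n : (n <= M)%N -> y n * (1 - c * n%:R * y 0%N) <= y 0%N.
  elim: n => [|n IH] nM; first by rewrite mulr0 mul0r subr0 mulr1.
  have {IH} := IH (ltnW nM); have := cn n (ltnW nM); rewrite -[n.+1%:R]natr1.
  set D := c * n%:R * y 0%N => D4 IH.
  have -> : 1 - c * (n%:R + 1) * y 0%N = (1 - D) - c * y 0%N by rewrite /D; ring.
  have [->|y1] := eqVneq (y n.+1) 0; first by rewrite mul0r.
  have yp : 0 < y n.+1 by rewrite lt_neqAle eq_sym y1 y0.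
  (* Multiplying this by 1 - D, which is nonnegative, and inserting the induction hypothesis leaves
     y_{n+1} (1 - D) <= y_0 (1 + c y_{n+1}), which is the invariant at n + 1. *)
  have st : y n.+1 <= y n * (1 + c * y n.+1).
    rewrite -(ler_pM2r yp); have := step n nM; lra.
  have cy : 0 <= 1 + c * y n.+1 by rewrite addr_ge0 // mulr_ge0.
  have D0 : 0 <= 1 - D by lra.
  have := ler_wpM2r D0 st; have := ler_wpM2r cy IH; lra.
move=> n nM; have := H n nM; have := cn n nM; have := y0 n; have := y0 0%N.
set D := c * n%:R * y 0%N; nra.
Qed.

End Recursion.

(** * Integration over the periodic cell *)

Section PlaneIntegral.
Context {R : realType}.
Implicit Types (f g : R * R -> R).

(** The sigma-algebra of [plane] is generated by products, while continuity speaks of the product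
    topology. The bridge is second countability: U is the union of the boxes with rational centre
    and radius that it contains. *)
Lemma plane_open_measurable (U : set (R * R)) : open U ->
  measurable (U : set (@plane R)).
Proof.
move=> oU.
pose B (q : rat * rat * rat) : set (R * R) :=
  ball (ratr q.1.1 : R) (ratr q.2) `*` ball (ratr q.1.2 : R) (ratr q.2).
have mB q : measurable (B q : set (@plane R)).
  by apply: measurableX; apply: open_measurable; exact: ball_open.
pose F q := if `[< B q `<=` U >] then B q else set0.
rewrite (_ : U = \bigcup_q F q).
  apply: countable_bigcupT_measurable => // q.
  by rewrite /F; case: asboolP.
apply/seteqP; split => [[x1 x2] Ux|x [q _]]; last first.
  by rewrite /F; case: asboolP => // h; exact: h.
have /nbhs_ballP[e /= e0 eU] := open_nbhs_nbhs (conj oU Ux).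
(* A box of radius r that contains the point has all its points within 2 r of it, hence the bound e
   / 2. *)
have [r /itvP re] := @rat_in_itvoo R 0 (e / 2) ltac:(by rewrite divr_gt0).
have r0 : 0 < ratr r :> R by rewrite re.
have re2 : ratr r < e / 2 :> R by rewrite re.
have [q1 h1] := @rat_in_itvoo R (x1 - ratr r) (x1 + ratr r) ltac:(by lra).
have [q2 h2] := @rat_in_itvoo R (x2 - ratr r) (x2 + ratr r) ltac:(by lra).
have c1 : ball (ratr q1 : R) (ratr r) x1.
  by rewrite -ball_normE /ball_ /= distrC ltr_distlC; rewrite in_itv in h1.
have c2 : ball (ratr q2 : R) (ratr r) x2.
  by rewrite -ball_normE /ball_ /= distrC ltr_distlC; rewrite in_itv in h2.
exists (q1, q2, r) => //; rewrite /F; case: asboolP => [_|]; first by split.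
case=> -[y1 y2] [/= b1 b2]; apply: eU; rewrite (splitr e).
split => /=.
  exact: ball_triangle (le_ball (ltW re2) (ball_sym c1)) (le_ball (ltW re2) b1).
exact: ball_triangle (le_ball (ltW re2) (ball_sym c2)) (le_ball (ltW re2) b2).
Qed.

Lemma plane_continuous_measurable f : continuous f -> measurable_fun [set: @plane R] f.
Proof.
move=> /continuousP cf; apply: (measurability _ (RGenOpens.measurableE R)).
move=> _ [_ [a [b ->] <-]]; rewrite setTI; apply: plane_open_measurable.
exact/cf/interval_open.
Qed.

Lemma cell_measurable : measurable (cell : set (@plane R)).
Proof. exact: measurableX. Qed.

Lemma pi2_gt0 : 0 < 2 * pi :> R.
Proof. by rewrite mulr_gt0 ?pi_gt0. Qed.

Lemma mu2_cell : mu2 (cell : set (@plane R)) = ((2 * pi) ^+ 2)%:E.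
Proof.
have h : lebesgue_measure (`[0, 2 * pi]%classic : set (measurableTypeR R)) = (2 * pi)%:E.
  by rewrite /= lebesgue_measure_itv /= lte_fin pi2_gt0 sube0.
apply: etrans (product_measure1E _ _ _ _) _; [exact: measurable_itv..|].
by rewrite [X in (X * _)%E]h [X in (_ * X)%E]h expr2 EFinM.
Qed.

Lemma continuous_cell_bounded f : continuous f -> [bounded f x | x in cell].
Proof.
move=> cf; have : compact (f @` cell).
  apply: continuous_compact; first exact: continuous_subspaceT.
  by apply: compact_setX; exact: segment_compact.
move=> /compact_bounded; rewrite /bounded_near /= => H.
by apply: filterS H => M HM x cx; apply: HM; exists x.
Qed.

Definition cellint f : Prop := (@mu2 R).-integrable cell (EFin \o f).

Lemma continuous_cellint f : continuous f -> cellint f.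
Proof.
move=> cf; apply: measurable_bounded_integrable.
- exact: cell_measurable.
- by rewrite mu2_cell ltry.
- by apply: measurable_funTS; exact: plane_continuous_measurable.
- exact: continuous_cell_bounded.
Qed.

Definition icell f : R := \int[mu2]_(x in cell) f x.

Lemma icellD f g : cellint f -> cellint g -> icell (fun x => f x + g x) = icell f + icell g.
Proof. by move=> hf hg; rewrite /icell RintegralD //; exact: cell_measurable. Qed.

Lemma icellZ (c : R) f : cellint f -> icell (fun x => c * f x) = c * icell f.
Proof. by move=> hf; rewrite /icell RintegralZl //; exact: cell_measurable. Qed.

Lemma cellintD f g : cellint f -> cellint g -> cellint (fun x => f x + g x).
Proof. by move=> hf hg; apply: (integrableD cell_measurable hf hg). Qed.

Lemma cellintZ (c : R) f : cellint f -> cellint (fun x => c * f x).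
Proof.
move=> hf; apply: eq_integrable (integrableZl cell_measurable c hf) => //.
exact: cell_measurable.
Qed.

End PlaneIntegral.

(** * Partial derivatives along lines and their integrals over the cell *)

Section PartialIntegration.
Context {R : realType}.
Implicit Types (f g : R * R -> R).

(** Equality of the difference quotients as functions transfers both the existence and the value of
    a partial derivative to one variable. *)
Lemma fst_quotient f (x y : R) :
  (fun h => h^-1 *: ((f \o shift (x, y)) (h *: (1, 0)) - f (x, y))) =
  (fun h : R => h^-1 *: (((fun t => f (t, y)) \o shift x) (h *: (1 : R)) - f (x, y))).
Proof.
by apply/funext => h /=; congr (_ *: (f _ - _)); congr pair; rewrite /= scaler0 add0r.
Qed.

Lemma snd_quotient f (x y : R) :
  (fun h => h^-1 *: ((f \o shift (x, y)) (h *: (0, 1)) - f (x, y))) =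
  (fun h : R => h^-1 *: (((fun t => f (x, t)) \o shift y) (h *: (1 : R)) - f (x, y))).
Proof.
by apply/funext => h /=; congr (_ *: (f _ - _)); congr pair; rewrite /= scaler0 add0r.
Qed.

Lemma d1E f (x y : R) : d1 f (x, y) = 'D_1 (fun t => f (t, y)) x.
Proof. by rewrite /d1 /derive fst_quotient. Qed.

Lemma d2E f (x y : R) : d2 f (x, y) = 'D_1 (fun t => f (x, t)) y.
Proof. by rewrite /d2 /derive snd_quotient. Qed.

Lemma derivable_fst f (x y : R) :
  derivable f (x, y) (1, 0) <-> derivable (fun t => f (t, y)) x 1.
Proof. by rewrite /derivable fst_quotient. Qed.

Lemma derivable_snd f (x y : R) :
  derivable f (x, y) (0, 1) <-> derivable (fun t => f (x, t)) y 1.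
Proof. by rewrite /derivable snd_quotient. Qed.

Lemma integral_derive_periodic (h : R -> R) :
  (forall t, derivable h t 1) -> continuous ('D_1 h) -> h (0 + 2 * pi) = h 0 ->
  (\int[lebesgue_measure]_(x in `[0%R, (2 * pi)%R]) ('D_1 h x)%:E = 0)%E.
Proof.
move=> dh ch per.
have hc t : {for t, continuous h}.
  by apply: differentiable_continuous; exact/derivable1_diffP.
rewrite (@continuous_FTC2 _ ('D_1 h) h).
- by rewrite -per add0r -EFinD subrr.
- exact: pi2_gt0.
- exact: continuous_subspaceT.
- split; first by move=> t _; exact: dh.
    by apply: cvg_at_right_filter; exact: hc.
  by apply: cvg_at_left_filter; exact: hc.
by move=> t _; rewrite derive1E.
Qed.

Lemma pair_continuousl (y : R) : continuous (fun t : R => (t, y)).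
Proof. by move=> t; apply: (@cvg_pair _ _ _ (nbhs t) (nbhs t) (nbhs y)); [exact: cvg_id | exact: cvg_cst]. Qed.

Lemma pair_continuousr (x : R) : continuous (fun t : R => (x, t)).
Proof. by move=> t; apply: (@cvg_pair _ _ _ (nbhs t) (nbhs x) (nbhs t)); [exact: cvg_cst | exact: cvg_id]. Qed.

(** Fubini holds for integrals over the whole plane, so f is extended by zero outside the cell and
    the restriction is then redistributed to the two variables. *)
Lemma integral_cell12 f : cellint f ->
  (\int[mu2]_(z in cell) (f z)%:E =
   \int[lebesgue_measure]_(x in `[0%R, (2 * pi)%R])
     \int[lebesgue_measure]_(y in `[0%R, (2 * pi)%R]) (f (x, y))%:E)%E.
Proof.
move=> hf; rewrite integral_mkcond.
have hf' := (integrable_mkcond _ cell_measurable).1 hf.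
rewrite -[LHS](integral12_prod_meas1 hf') [RHS]integral_mkcond.
apply: eq_integral => x _; rewrite /fubini_F /patch.
case: ifPn => [xI|xI].
  rewrite [RHS]integral_mkcond; apply: eq_integral => y _; rewrite /patch.
  rewrite (_ : ((x, y) \in cell) = (y \in `[0, 2 * pi]%classic)) //.
  move: xI; rewrite inE /cell => xI; apply/idP/idP; rewrite !inE; last by split.
  by case.
rewrite integral0_eq // => y _.
case: ifPn => //; rewrite inE => -[xI' _]; move: xI; rewrite notin_setE => h.
by case: h.
Qed.

Lemma integral_cell21 f : cellint f ->
  (\int[mu2]_(z in cell) (f z)%:E =
   \int[lebesgue_measure]_(y in `[0%R, (2 * pi)%R])
     \int[lebesgue_measure]_(x in `[0%R, (2 * pi)%R]) (f (x, y))%:E)%E.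
Proof.
move=> hf; rewrite integral_mkcond.
have hf' := (integrable_mkcond _ cell_measurable).1 hf.
rewrite -[LHS](integral21_prod_meas1 hf') [RHS]integral_mkcond.
apply: eq_integral => y _; rewrite /fubini_G /patch.
case: ifPn => [yI|yI].
  rewrite [RHS]integral_mkcond; apply: eq_integral => x _; rewrite /patch.
  rewrite (_ : ((x, y) \in cell) = (x \in `[0, 2 * pi]%classic)) //.
  move: yI; rewrite inE /cell => yI; apply/idP/idP; rewrite !inE; last by split.
  by case.
rewrite integral0_eq // => x _.
case: ifPn => //; rewrite inE => -[_ yI']; move: yI; rewrite notin_setE => h.
by case: h.
Qed.

(** The order of integration puts the differentiated variable inside, where the fundamental theorem
    of calculus and periodicity give 0 on every line. *)
Lemma icell_d1 f : biperiodic f -> (forall x, derivable f x (1, 0)) ->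
  continuous (d1 f) -> icell (d1 f) = 0.
Proof.
move=> per df cf; rewrite /icell /Rintegral integral_cell21; last exact: continuous_cellint.
rewrite integral0_eq // => y _.
under eq_integral do rewrite d1E.
apply: integral_derive_periodic.
- by move=> t; apply/derivable_fst.
- have -> : 'D_1 (fun t => f (t, y)) = d1 f \o (fun t => (t, y)).
    by apply/funext => t /=; rewrite d1E.
  by move=> t; apply: continuous_comp; [exact: pair_continuousl | exact: cf].
by have [] := per (0, y).
Qed.

Lemma icell_d2 f : biperiodic f -> (forall x, derivable f x (0, 1)) ->
  continuous (d2 f) -> icell (d2 f) = 0.
Proof.
move=> per df cf; rewrite /icell /Rintegral integral_cell12; last exact: continuous_cellint.
rewrite integral0_eq // => x _.
under eq_integral do rewrite d2E.
apply: integral_derive_periodic.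
- by move=> t; apply/derivable_snd.
- have -> : 'D_1 (fun t => f (x, t)) = d2 f \o (fun t => (x, t)).
    by apply/funext => t /=; rewrite d2E.
  by move=> t; apply: continuous_comp; [exact: pair_continuousr | exact: cf].
by have [] := per (x, 0).
Qed.

End PartialIntegration.

(** * Trigonometric polynomials and Fourier coefficients *)

Section TrigonometricPolynomials.
Context {R : realType}.
Implicit Types (f g : R * R -> R) (k j m : int * int) (x : R * R).

Definition cosk k x : R := cos (dotk k x).
Definition sink k x : R := sin (dotk k x).

Lemma dotkN k x : dotk (- k) x = - dotk k x :> R.
Proof. by rewrite /dotk /= !mulrNz; ring. Qed.

Lemma dotkD k j x : dotk (k + j) x = dotk k x + dotk j x :> R.
Proof. by rewrite /dotk /= !intrD; ring. Qed.

Lemma dotk0 x : dotk 0 x = 0 :> R.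
Proof. by rewrite /dotk /= !mul0r addr0. Qed.

Lemma coskN k x : cosk (- k) x = cosk k x.
Proof. by rewrite /cosk dotkN cosN. Qed.

Lemma sinkN k x : sink (- k) x = - sink k x.
Proof. by rewrite /sink dotkN sinN. Qed.

Lemma cos_int_period (t : R) (n : int) : cos (t + n%:~R * (2 * pi)) = cos t.
Proof.
have H (u : R) (p : nat) : cos (u + p%:R * (2 * pi)) = cos u.
  elim: p => [|p IH]; first by rewrite mul0r addr0.
  rewrite -IH -[RHS]cosD2pi; congr cos.
  by rewrite -[p.+1%:R]natr1 mulr2n; ring.
case: n => p; first exact: H.
by rewrite NegzE mulrNz mulNr -[LHS](H _ p.+1) subrK.
Qed.

Lemma sin_int_period (t : R) (n : int) : sin (t + n%:~R * (2 * pi)) = sin t.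
Proof.
by rewrite -!cosBpihalf addrAC cos_int_period.
Qed.

Lemma cosk_biperiodic k : biperiodic (cosk k).
Proof.
move=> x; split; rewrite /cosk /dotk /=.
  by rewrite -[RHS](cos_int_period _ k.1); congr cos; ring.
by rewrite -[RHS](cos_int_period _ k.2); congr cos; ring.
Qed.

Lemma sink_biperiodic k : biperiodic (sink k).
Proof.
move=> x; split; rewrite /sink /dotk /=.
  by rewrite -[RHS](sin_int_period _ k.1); congr sin; ring.
by rewrite -[RHS](sin_int_period _ k.2); congr sin; ring.
Qed.

Lemma differentiable_dotk k x : differentiable (dotk k : R * R -> R) x.
Proof.
have d1 : differentiable (@fst R R) x.
  by apply: (@linear_differentiable _ _ _ (@fst R R)) => y; exact: cvg_fst.
have d2 : differentiable (@snd R R) x.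
  by apply: (@linear_differentiable _ _ _ (@snd R R)) => y; exact: cvg_snd.
exact: (differentiableD (differentiableZ _ d1) (differentiableZ _ d2)).
Qed.

Lemma differentiable_cosk k x : differentiable (cosk k) x.
Proof.
apply: (@differentiable_comp _ _ _ _ (dotk k) cos); first exact: differentiable_dotk.
exact/derivable1_diffP/derivable_cos.
Qed.

Lemma differentiable_sink k x : differentiable (sink k) x.
Proof.
apply: (@differentiable_comp _ _ _ _ (dotk k) sin); first exact: differentiable_dotk.
exact/derivable1_diffP/derivable_sin.
Qed.

Lemma is_derive_affine (a b t : R) : is_derive t 1 (fun t : R => a * t + b) a.
Proof.
have := is_deriveD (is_deriveZ a (is_derive_id t 1)) (is_derive_cst b t 1).
by rewrite addr0 /GRing.scale /= mulr1.
Qed.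

Lemma derive_cos_affine (a b t : R) : 'D_1 (fun t => cos (a * t + b)) t = - a * sin (a * t + b).
Proof.
have := @is_derive1_comp _ _ (fun t : R => a * t + b) _ _ _ (is_derive_cos (a * t + b)) (is_derive_affine a b t).
by move=> /@derive_val ->; rewrite mulrC mulrN mulNr.
Qed.

Lemma derive_sin_affine (a b t : R) : 'D_1 (fun t => sin (a * t + b)) t = a * cos (a * t + b).
Proof.
have := @is_derive1_comp _ _ (fun t : R => a * t + b) _ _ _ (is_derive_sin (a * t + b)) (is_derive_affine a b t).
by move=> /@derive_val ->; rewrite mulrC.
Qed.

Lemma d1_cosk k : d1 (cosk k) = (fun x => - k.1%:~R * sink k x).
Proof. by apply/funext => -[x y]; rewrite d1E; exact: (derive_cos_affine k.1%:~R (k.2%:~R * y) x). Qed.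

Lemma d1_sink k : d1 (sink k) = (fun x => k.1%:~R * cosk k x).
Proof. by apply/funext => -[x y]; rewrite d1E; exact: (derive_sin_affine k.1%:~R (k.2%:~R * y) x). Qed.

Lemma d2_cosk k : d2 (cosk k) = (fun x => - k.2%:~R * sink k x).
Proof.
apply/funext => -[x y]; rewrite d2E /cosk /sink /dotk /= [_ + k.2%:~R * y]addrC.
by rewrite -derive_cos_affine; congr ('D_1 _ y); apply/funext => t; rewrite addrC.
Qed.

Lemma d2_sink k : d2 (sink k) = (fun x => k.2%:~R * cosk k x).
Proof.
apply/funext => -[x y]; rewrite d2E /cosk /sink /dotk /= [_ + k.2%:~R * y]addrC.
by rewrite -derive_sin_affine; congr ('D_1 _ y); apply/funext => t; rewrite addrC.
Qed.

Lemma d1D f g : (forall x, derivable f x (1, 0)) -> (forall x, derivable g x (1, 0)) ->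
  d1 (fun x => f x + g x) = (fun x => d1 f x + d1 g x).
Proof. by move=> df dg; apply/funext => x; rewrite /d1 -deriveD. Qed.

Lemma d2D f g : (forall x, derivable f x (0, 1)) -> (forall x, derivable g x (0, 1)) ->
  d2 (fun x => f x + g x) = (fun x => d2 f x + d2 g x).
Proof. by move=> df dg; apply/funext => x; rewrite /d2 -deriveD. Qed.

Lemma d1Z (c : R) f : (forall x, derivable f x (1, 0)) ->
  d1 (fun x => c * f x) = (fun x => c * d1 f x).
Proof. by move=> df; apply/funext => x; rewrite /d1 -[RHS](deriveZ c (df x)). Qed.

Lemma d2Z (c : R) f : (forall x, derivable f x (0, 1)) ->
  d2 (fun x => c * f x) = (fun x => c * d2 f x).
Proof. by move=> df; apply/funext => x; rewrite /d2 -[RHS](deriveZ c (df x)). Qed.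

(** An arbitrary list of modes allows induction on it, and covers single modes as well as
    [modes N]. *)
Definition trig (r : seq (int * int)) (a b : int * int -> R) x : R :=
  \sum_(k <- r) (a k * cosk k x + b k * sink k x).

Lemma trig_nil a b : trig [::] a b = fun=> 0.
Proof. by apply/funext => x; rewrite /trig big_nil. Qed.

Lemma trig_cons k r a b :
  trig (k :: r) a b = fun x => (a k * cosk k x + b k * sink k x) + trig r a b x.
Proof. by apply/funext => x; rewrite /trig big_cons. Qed.

Lemma differentiable_mode k (c d : R) x :
  differentiable (fun x => c * cosk k x + d * sink k x) x.
Proof.
exact: (differentiableD (differentiableZ _ (differentiable_cosk k x))
  (differentiableZ _ (differentiable_sink k x))).
Qed.

Lemma differentiable_trig r a b x : differentiable (trig r a b) x.
Proof.
elim: r => [|k r IH]; first by rewrite trig_nil; exact: differentiable_cst.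
by rewrite trig_cons; exact: (differentiableD (differentiable_mode k _ _ x) IH).
Qed.

Lemma continuous_trig r a b : continuous (trig r a b).
Proof. by move=> x; apply: differentiable_continuous; exact: differentiable_trig. Qed.

Lemma trig_biperiodic r a b : biperiodic (trig r a b).
Proof.
by move=> x; split; apply: eq_bigr => k _; have [c1 c2] := cosk_biperiodic k x;
  have [s1 s2] := sink_biperiodic k x; rewrite ?c1 ?c2 ?s1 ?s2.
Qed.

Lemma d1_trig r a b :
  d1 (trig r a b) = trig r (fun k => k.1%:~R * b k) (fun k => - k.1%:~R * a k).
Proof.
elim: r => [|k r IH].
  by rewrite !trig_nil; apply/funext => x; rewrite /d1 derive_cst.
rewrite trig_cons d1D ?IH ?trig_cons.
- apply/funext => x; congr (_ + _).
  rewrite d1D ?d1Z ?d1_cosk ?d1_sink => [|y|y|y|y]; first ring.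
  + exact/diff_derivable/differentiable_sink.
  + exact/diff_derivable/differentiable_cosk.
  + exact/diff_derivable/differentiableZ/differentiable_cosk.
  + exact/diff_derivable/differentiableZ/differentiable_sink.
- by move=> x; apply: diff_derivable; exact: differentiable_mode.
- by move=> x; apply: diff_derivable; exact: differentiable_trig.
Qed.

Lemma d2_trig r a b :
  d2 (trig r a b) = trig r (fun k => k.2%:~R * b k) (fun k => - k.2%:~R * a k).
Proof.
elim: r => [|k r IH].
  by rewrite !trig_nil; apply/funext => x; rewrite /d2 derive_cst.
rewrite trig_cons d2D ?IH ?trig_cons.
- apply/funext => x; congr (_ + _).
  rewrite d2D ?d2Z ?d2_cosk ?d2_sink => [|y|y|y|y]; first ring.
  + exact/diff_derivable/differentiable_sink.
  + exact/diff_derivable/differentiable_cosk.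
  + exact/diff_derivable/differentiableZ/differentiable_cosk.
  + exact/diff_derivable/differentiableZ/differentiable_sink.
- by move=> x; apply: diff_derivable; exact: differentiable_mode.
- by move=> x; apply: diff_derivable; exact: differentiable_trig.
Qed.

(** Partial derivatives only change the coefficients. This makes the pure modes admissible test
    functions in [weakly_div_free]. *)
Lemma smooth_trig r a b : smooth (trig r a b).
Proof.
move=> w x; suff [a' [b' ->]] : exists a' b', partials w (trig r a b) = trig r a' b'.
  exact: differentiable_trig.
elim: w => [|[] w [a' [b' /= ->]]]; first by exists a, b.
  by rewrite d1_trig; eexists; eexists.
by rewrite d2_trig; eexists; eexists.
Qed.

Lemma in_XNP N f : in_XN N f <-> exists a b, f = trig (modes N) a b.
Proof.
split=> -[a [b h]]; exists a, b; first exact/funext.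
by rewrite h.
Qed.

End TrigonometricPolynomials.

(** * Fourier coefficients of derivatives and of single modes *)

Section FourierCoefficients.
Context {R : realType}.
Import complex.
Implicit Types (f g : R * R -> R) (k j m : int * int) (x : R * R) (N : nat).

Lemma cellintM f g : cellint f -> continuous g -> cellint (fun x => f x * g x).
Proof.
move=> hf cg; apply: eq_integrable (integrableMl cell_measurable hf _ _).
- exact: cell_measurable.
- by move=> x _ /=; rewrite EFinM.
- by apply: measurable_funTS; exact: plane_continuous_measurable.
- exact: continuous_cell_bounded.
Qed.

Lemma continuous_cosk k : continuous (cosk k : R * R -> R).
Proof. by move=> x; apply: differentiable_continuous; exact: differentiable_cosk. Qed.

Lemma continuous_sink k : continuous (sink k : R * R -> R).
Proof. by move=> x; apply: differentiable_continuous; exact: differentiable_sink. Qed.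

Lemma cellint_cos f k : cellint f -> cellint (fun x => f x * cosk k x).
Proof. by move=> hf; apply: cellintM => //; exact: continuous_cosk. Qed.

Lemma cellint_sin f k : cellint f -> cellint (fun x => f x * sink k x).
Proof. by move=> hf; apply: cellintM => //; exact: continuous_sink. Qed.

Lemma icellN f : cellint f -> icell (fun x => - f x) = - icell f.
Proof. by move=> hf; rewrite -mulN1r -icellZ //; congr icell; apply/funext => x; rewrite mulN1r. Qed.

Lemma fourierE f k : cellint f ->
  fourier f k = Complex (icell (fun x => f x * cosk k x)) (- icell (fun x => f x * sink k x)).
Proof.
move=> hf; rewrite -icellN; last exact: cellint_sin.
by congr Complex; apply: eq_Rintegral => x _; rewrite mulrN.
Qed.

Lemma fourierD f g k : cellint f -> cellint g ->
  fourier (fun x => f x + g x) k = fourier f k + fourier g k.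
Proof.
move=> hf hg; rewrite !fourierE //; last exact: cellintD.
rewrite -[RHS]/(Complex (_ + _) (_ + _)) -opprD -!icellD; try exact: cellint_cos; try exact: cellint_sin.
by congr (Complex _ (- _)); congr icell; apply/funext => x; rewrite mulrDl.
Qed.

Lemma fourierZ (c : R) f k : cellint f ->
  fourier (fun x => c * f x) k = real_complex R c * fourier f k.
Proof.
move=> hf; rewrite !fourierE //; last exact: cellintZ.
rewrite /GRing.mul /= !mul0r subr0 addr0 mulrN -!icellZ; [|exact: cellint_sin|exact: cellint_cos].
by congr (Complex _ (- _)); congr icell; apply/funext => x; rewrite mulrA.
Qed.

Lemma fourier_conj f k : cellint f -> fourier f (- k) = conjc (fourier f k).
Proof.
move=> hf; rewrite !fourierE //= opprK; congr Complex.
  by congr icell; apply/funext => x; rewrite coskN.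
rewrite -icellN; last exact: cellint_sin.
by congr icell; apply/funext => x; rewrite sinkN mulrN opprK.
Qed.

Lemma cellint_sum (I : Type) (r : seq I) (F : I -> R * R -> R) :
  (forall i, cellint (F i)) -> cellint (fun x => \sum_(i <- r) F i x).
Proof.
move=> hF; elim: r => [|i r IH].
  by apply: continuous_cellint => x; under eq_fun do rewrite big_nil; exact: cvg_cst.
by under eq_fun do rewrite big_cons; exact: cellintD.
Qed.

Lemma icell0 : icell (fun=> 0 : R) = 0.
Proof. by rewrite /icell Rintegral_cst ?mul0r //; exact: cell_measurable. Qed.

Lemma icell_sum (I : Type) (r : seq I) (F : I -> R * R -> R) :
  (forall i, cellint (F i)) ->
  icell (fun x => \sum_(i <- r) F i x) = \sum_(i <- r) icell (F i).
Proof.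
move=> hF; elim: r => [|i r IH].
  by rewrite big_nil -[RHS]icell0; congr icell; apply/funext => x; rewrite big_nil.
rewrite big_cons -IH -icellD //; last exact: cellint_sum.
by congr icell; apply/funext => x; rewrite big_cons.
Qed.

Lemma biperiodicM f g : biperiodic f -> biperiodic g -> biperiodic (fun x => f x * g x).
Proof.
by move=> pf pg x; have [f1 f2] := pf x; have [g1 g2] := pg x; rewrite f1 f2 g1 g2.
Qed.

Lemma continuousM2 f g : continuous f -> continuous g -> continuous (fun x => f x * g x).
Proof. by move=> cf cg x; apply: cvgM; [exact: cf | exact: cg]. Qed.

Lemma continuousD2 f g : continuous f -> continuous g -> continuous (fun x => f x + g x).
Proof. by move=> cf cg x; apply: cvgD; [exact: cf | exact: cg]. Qed.

Lemma continuousZ2 (c : R) f : continuous f -> continuous (fun x => c * f x).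
Proof. by move=> cf; apply: continuousM2 => // x; exact: cvg_cst. Qed.

Section DerivativeCoefficients.
Context {f : R * R -> R}.
Hypotheses (pf : biperiodic f) (df : forall x, differentiable f x).

Let cf : continuous f.
Proof. by move=> x; exact: differentiable_continuous. Qed.

(** Integration by parts: the derivative of f g has zero integral. Continuity of [d1 f] is a
    separate hypothesis because it does not follow from differentiability, which is all that is
    known of the pressure. *)
Lemma icell_d1M g (dg : R * R -> R) : biperiodic g -> (forall x, differentiable g x) ->
  continuous (d1 f) -> d1 g = dg -> continuous dg ->
  icell (fun x => d1 f x * g x) = - icell (fun x => f x * dg x).
Proof.
move=> pg hg cdf edg cdg.
have cg : continuous g by move=> x; exact: differentiable_continuous.
have E : d1 (fun x => f x * g x) = (fun x => f x * dg x + d1 f x * g x).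
  apply/funext => x; rewrite -edg {1}/d1 (@deriveM _ _ f g x); [|exact: diff_derivable..].
  by rewrite /GRing.scale /= [d1 f x * _]mulrC.
apply/eqP; rewrite -addr_eq0 addrC; apply/eqP.
rewrite -icellD; try (apply: continuous_cellint; exact: continuousM2).
rewrite -E; apply: icell_d1.
- exact: biperiodicM.
- by move=> x; apply: diff_derivable; exact: (differentiableM (df x) (hg x)).
- by rewrite E; apply: continuousD2; exact: continuousM2.
Qed.

Lemma icell_d2M g (dg : R * R -> R) : biperiodic g -> (forall x, differentiable g x) ->
  continuous (d2 f) -> d2 g = dg -> continuous dg ->
  icell (fun x => d2 f x * g x) = - icell (fun x => f x * dg x).
Proof.
move=> pg hg cdf edg cdg.
have cg : continuous g by move=> x; exact: differentiable_continuous.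
have E : d2 (fun x => f x * g x) = (fun x => f x * dg x + d2 f x * g x).
  apply/funext => x; rewrite -edg {1}/d2 (@deriveM _ _ f g x); [|exact: diff_derivable..].
  by rewrite /GRing.scale /= [d2 f x * _]mulrC.
apply/eqP; rewrite -addr_eq0 addrC; apply/eqP.
rewrite -icellD; try (apply: continuous_cellint; exact: continuousM2).
rewrite -E; apply: icell_d2.
- exact: biperiodicM.
- by move=> x; apply: diff_derivable; exact: (differentiableM (df x) (hg x)).
- by rewrite E; apply: continuousD2; exact: continuousM2.
Qed.

Lemma icell_ZM (c : R) g : continuous g ->
  icell (fun x => f x * (c * g x)) = c * icell (fun x => f x * g x).
Proof.
move=> cg; rewrite -icellZ; last by apply: continuous_cellint; exact: continuousM2.
by congr icell; apply/funext => x; rewrite mulrCA.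
Qed.

Lemma intr_i (n : int) (z : R[i]) :
  'i%C * n%:~R * z = Complex (- (n%:~R * Im z)) (n%:~R * Re z).
Proof.
rewrite -(rmorph_int (real_complex R)); case: z => u v.
by apply/eqP; rewrite eq_complex /=; apply/andP; split; apply/eqP; ring.
Qed.

Lemma fourier_d1 k : continuous (d1 f) -> fourier (d1 f) k = 'i%C * k.1%:~R * fourier f k.
Proof.
move=> cdf; rewrite intr_i !fourierE; [|exact: continuous_cellint..] => /=.
rewrite (icell_d1M _ _ (cosk_biperiodic k) (differentiable_cosk k) cdf (d1_cosk k)); last first.
  by apply: continuousZ2; exact: continuous_sink.
rewrite (icell_d1M _ _ (sink_biperiodic k) (differentiable_sink k) cdf (d1_sink k)); last first.
  by apply: continuousZ2; exact: continuous_cosk.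
rewrite !icell_ZM; [|first [exact: continuous_sink | exact: continuous_cosk]..].
by congr Complex; rewrite ?opprK ?mulNr ?mulrN ?opprK.
Qed.

Lemma fourier_d2 k : continuous (d2 f) -> fourier (d2 f) k = 'i%C * k.2%:~R * fourier f k.
Proof.
move=> cdf; rewrite intr_i !fourierE; [|exact: continuous_cellint..] => /=.
rewrite (icell_d2M _ _ (cosk_biperiodic k) (differentiable_cosk k) cdf (d2_cosk k)); last first.
  by apply: continuousZ2; exact: continuous_sink.
rewrite (icell_d2M _ _ (sink_biperiodic k) (differentiable_sink k) cdf (d2_sink k)); last first.
  by apply: continuousZ2; exact: continuous_cosk.
rewrite !icell_ZM; [|first [exact: continuous_sink | exact: continuous_cosk]..].
by congr Complex; rewrite ?opprK ?mulNr ?mulrN ?opprK.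
Qed.

End DerivativeCoefficients.

(** Up to a nonzero integer factor k.1 or k.2, each of the two modes is a partial derivative of the
    other, and such derivatives integrate to 0. *)
Lemma icell_cosk_sink k : k != 0 -> icell (cosk k) = 0 :> R /\ icell (sink k) = 0 :> R.
Proof.
have H (n : int) (u v : R) : n != 0 -> n%:~R * u = 0 -> n%:~R * v = 0 -> u = 0 /\ v = 0.
  by move=> n0 /eqP + /eqP; rewrite !mulf_eq0 intr_eq0 (negPf n0) => /eqP -> /eqP ->.
move=> k0.
have ZC (n : int) : icell (fun x => n%:~R * cosk k x) = n%:~R * icell (cosk k) :> R.
  by rewrite icellZ //; apply: continuous_cellint; exact: continuous_cosk.
have ZS (n : int) : icell (fun x => - n%:~R * sink k x) = - (n%:~R * icell (sink k)) :> R.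
  by rewrite icellZ ?mulNr //; apply: continuous_cellint; exact: continuous_sink.
have [k1|k1] := eqVneq k.1 0; last first.
  apply: (H k.1) => //.
    rewrite -ZC -d1_sink icell_d1 //; first exact: sink_biperiodic.
      by move=> x; apply: diff_derivable; exact: differentiable_sink.
    by rewrite d1_sink; apply: continuousZ2; exact: continuous_cosk.
  apply: oppr_inj; rewrite oppr0 -ZS -d1_cosk icell_d1 //; first exact: cosk_biperiodic.
    by move=> x; apply: diff_derivable; exact: differentiable_cosk.
  by rewrite d1_cosk; apply: continuousZ2; exact: continuous_sink.
have k2 : k.2 != 0 by move: k0; case: k k1 {ZC ZS} => a b /= ->; apply: contra => /eqP ->.
apply: (H k.2) => //.
  rewrite -ZC -d2_sink icell_d2 //; first exact: sink_biperiodic.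
    by move=> x; apply: diff_derivable; exact: differentiable_sink.
  by rewrite d2_sink; apply: continuousZ2; exact: continuous_cosk.
apply: oppr_inj; rewrite oppr0 -ZS -d2_cosk icell_d2 //; first exact: cosk_biperiodic.
  by move=> x; apply: diff_derivable; exact: differentiable_cosk.
by rewrite d2_cosk; apply: continuousZ2; exact: continuous_sink.
Qed.

Definition area : R := (2 * pi) ^+ 2.

Lemma area_gt0 : 0 < area. Proof. by rewrite exprn_gt0 // pi2_gt0. Qed.

Lemma icell_cosk k : icell (cosk k) = area * (k == 0)%:R.
Proof.
have [->|k0] := eqVneq k 0; last by rewrite mulr0; have [] := icell_cosk_sink _ k0.
rewrite mulr1 (_ : cosk 0 = fun=> 1); last by apply/funext => x; rewrite /cosk dotk0 cos0.
rewrite /icell Rintegral_cst; last exact: cell_measurable.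
by rewrite mul1r mu2_cell.
Qed.

Lemma icell_sink k : icell (sink k) = 0 :> R.
Proof.
have [->|k0] := eqVneq k 0; last by have [] := icell_cosk_sink _ k0.
by rewrite (_ : sink 0 = fun=> 0) ?icell0 //; apply/funext => x; rewrite /sink dotk0 sin0.
Qed.

Lemma icell_comb (c d : R) f g : continuous f -> continuous g ->
  icell (fun x => c * f x + d * g x) = c * icell f + d * icell g.
Proof.
by move=> cf cg; rewrite icellD ?icellZ //; try apply: cellintZ; exact: continuous_cellint.
Qed.

Lemma coskB k j x : cosk (k - j) x = cosk k x * cosk j x + sink k x * sink j x.
Proof. by rewrite /cosk /sink dotkD dotkN cosB. Qed.

Lemma coskD k j x : cosk (k + j) x = cosk k x * cosk j x - sink k x * sink j x.
Proof. by rewrite /cosk /sink dotkD cosD. Qed.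

Lemma sinkB k j x : sink (k - j) x = sink k x * cosk j x - cosk k x * sink j x.
Proof. by rewrite /cosk /sink dotkD dotkN sinB. Qed.

Lemma sinkD k j x : sink (k + j) x = sink k x * cosk j x + cosk k x * sink j x.
Proof. by rewrite /cosk /sink dotkD sinD. Qed.

(** Product-to-sum formulas. A real mode has both frequencies j and -j, hence two indicators; for j
    = 0 they coincide and compensate the factor 1/2. *)
Lemma fourier_mode (c d : R) j k :
  fourier (fun x => c * cosk j x + d * sink j x) k =
  real_complex R (area / 2) *
  Complex (c * ((j == k)%:R + (j == - k)%:R)) (d * ((j == - k)%:R - (j == k)%:R)).
Proof.
have cc := @continuous_cosk; have cs := @continuous_sink.
rewrite fourierE; last first.
  by apply: continuous_cellint; apply: continuousD2; exact: continuousZ2.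
(* The factors 1 give the sum the nested shape to which [icell_comb] applies twice. *)
have -> : (fun x => (c * cosk j x + d * sink j x) * cosk k x) =
  (fun x => 1 * ((c / 2) * cosk (j - k) x + (c / 2) * cosk (j + k) x)
     + 1 * ((d / 2) * sink (j - k) x + (d / 2) * sink (j + k) x)).
  by apply/funext => x; rewrite coskB coskD sinkB sinkD; field.
have -> : (fun x => (c * cosk j x + d * sink j x) * sink k x) =
  (fun x => 1 * ((c / 2) * sink (j + k) x + (- c / 2) * sink (j - k) x)
     + 1 * ((d / 2) * cosk (j - k) x + (- d / 2) * cosk (j + k) x)).
  by apply/funext => x; rewrite coskB coskD sinkB sinkD; field.
rewrite !icell_comb; try (by []); try (by apply: continuousD2; exact: continuousZ2).
rewrite !icell_cosk !icell_sink subr_eq0 -(addr_eq0 j k).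
by apply/eqP; rewrite eq_complex /=; apply/andP; split; apply/eqP; field.
Qed.

End FourierCoefficients.

(** * Truncation, convolution and the Parseval identity *)

Section Truncation.
Context {R : realType}.
Import complex.
Implicit Types (f g h : R * R -> R) (k j m : int * int) (x : R * R) (N : nat).

Lemma Im_add (z1 z2 : R[i]) : Im (z1 + z2) = Im z1 + Im z2.
Proof. by case: z1; case: z2. Qed.

Lemma Im_sum (I : Type) (r : seq I) (F : I -> R[i]) :
  Im (\sum_(i <- r) F i) = \sum_(i <- r) Im (F i).
Proof. by rewrite (big_morph _ Im_add (erefl (Im (0 : R[i])))). Qed.

Lemma complexP (z1 z2 : R[i]) : Re z1 = Re z2 -> Im z1 = Im z2 -> z1 = z2.
Proof. by case: z1 => ? ?; case: z2 => ? ? /= -> ->. Qed.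

Lemma sum_modesN (V : nmodType) N (F : int * int -> V) :
  \sum_(k <- modes N) F (- k) = \sum_(k <- modes N) F k.
Proof.
rewrite -(big_map (fun k => - k) xpredT F); apply: perm_big; apply: uniq_perm.
- by rewrite map_inj_uniq ?modes_uniq //; exact: oppr_inj.
- exact: modes_uniq.
move=> k; rewrite -modesN; apply/mapP/idP => [[j jm ->]|km]; first by rewrite opprK.
by exists (- k); rewrite ?opprK.
Qed.

Lemma sum_indicator N (F : int * int -> R) k :
  \sum_(j <- modes N) F j * (j == k)%:R = if k \in modes N then F k else 0.
Proof.
case: ifPn => km.
  rewrite (bigD1_seq k) ?modes_uniq //= eqxx mulr1 big1 ?addr0 // => j jk.
  by rewrite (negPf jk) mulr0.
rewrite big_seq big1 // => j jm; rewrite (_ : (j == k) = false) ?mulr0 //.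
by apply: contraNF km => /eqP <-.
Qed.

Lemma cellint_trig r (a b : int * int -> R) : cellint (trig r a b).
Proof. by apply: continuous_cellint; exact: continuous_trig. Qed.

Lemma fourier_trig r (a b : int * int -> R) k : fourier (trig r a b) k =
  \sum_(j <- r) fourier (fun x => a j * cosk j x + b j * sink j x) k.
Proof.
elim: r => [|j r IH].
  rewrite big_nil trig_nil fourierE; last by apply: continuous_cellint => x; exact: cvg_cst.
  by apply: complexP => /=; under eq_fun do rewrite mul0r; rewrite icell0 ?oppr0.
rewrite big_cons -IH trig_cons fourierD //; last exact: cellint_trig.
by apply: continuous_cellint => x; apply: differentiable_continuous; exact: differentiable_mode.
Qed.

(** The box contains k together with -k, so the cosine and sine representation is redundant, and a
    coefficient sees only symmetrised combinations of a and b. *)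
Lemma fourier_trig_modes N (a b : int * int -> R) k : fourier (trig (modes N) a b) k =
  if k \in modes N then
    real_complex R (area / 2) * Complex (a k + a (- k)) (b (- k) - b k)
  else 0.
Proof.
rewrite fourier_trig.
under eq_bigr do rewrite fourier_mode.
rewrite -mulr_sumr.
set S := (X in _ * X).
have -> : S = if k \in modes N then Complex (a k + a (- k)) (b (- k) - b k) else 0.
  apply: complexP; rewrite /S ?Re_sum ?Im_sum /=.
    under eq_bigr do rewrite mulrDr.
    by rewrite big_split /= !sum_indicator modesN; case: ifP; rewrite //= addr0.
  under eq_bigr do rewrite mulrBr.
  by rewrite sumrB !sum_indicator modesN; case: ifP; rewrite //= subr0.
by case: ifP; rewrite ?mulr0.
Qed.

(** Normalised so that Fourier sums carry no prefactor and products become plain convolutions. *)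
Definition fcoef f k : R[i] := real_complex R area^-1 * fourier f k.

Lemma fcoef_conj f k : cellint f -> fcoef f (- k) = conjc (fcoef f k).
Proof. by move=> hf; rewrite /fcoef fourier_conj // rmorphM /= oppr0. Qed.

Lemma PiN_trig N h :
  PiN N h = trig (modes N) (fun k => Re (fcoef h k)) (fun k => - Im (fcoef h k)).
Proof.
apply/funext => x; rewrite /PiN mulr_sumr; apply: eq_bigr => k _.
by rewrite /fcoef /expi -/(cosk k x) -/(sink k x) -/area; case: (fourier h k) => u v /=; ring.
Qed.

Lemma fcoef_PiN N h k : cellint h ->
  fcoef (PiN N h) k = if k \in modes N then fcoef h k else 0.
Proof.
move=> hh; rewrite {1}/fcoef PiN_trig fourier_trig_modes fcoef_conj //.
case: ifP => _; last by rewrite mulr0.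
have a0 : area != 0 :> R by rewrite gt_eqF ?area_gt0.
by case: (fcoef h k) => u v; apply: complexP => /=; field.
Qed.

Lemma PiN_id N f : in_XN N f -> PiN N f = f.
Proof.
move=> /in_XNP[a [b ->]]; rewrite PiN_trig; apply/funext => x; rewrite /trig.
have a0 : area != 0 :> R by rewrite gt_eqF ?area_gt0.
(* The coefficients of [PiN] need not be a and b: they are the averages over k and -k, which define
   the same function because the box is symmetric. *)
transitivity (\sum_(k <- modes N) ((a k * cosk k x + b k * sink k x) / 2 +
   (a (- k) * cosk (- k) x + b (- k) * sink (- k) x) / 2)).
  rewrite big_seq [RHS]big_seq; apply: eq_bigr => k km.
  rewrite /fcoef fourier_trig_modes km coskN sinkN /=; field => //.
rewrite big_split /= (sum_modesN _ N (fun k => (a k * cosk k x + b k * sink k x) / 2)) -big_split /=.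
by apply: eq_bigr => k _; rewrite -splitr.
Qed.

Lemma fcoef_notin N f k : in_XN N f -> k \notin modes N -> fcoef f k = 0.
Proof.
by move=> /in_XNP[a [b ->]] km; rewrite /fcoef fourier_trig_modes (negPf km) mulr0.
Qed.

Lemma in_XN_continuous N f : in_XN N f -> continuous f.
Proof. by move=> /in_XNP[a [b ->]]; exact: continuous_trig. Qed.

Lemma in_XN_cellint N f : in_XN N f -> cellint f.
Proof. by move=> h; apply: continuous_cellint; exact: in_XN_continuous h. Qed.

Lemma in_XN_differentiable N f x : in_XN N f -> differentiable f x.
Proof. by move=> /in_XNP[a [b ->]]; exact: differentiable_trig. Qed.

Lemma in_XN_biperiodic N f : in_XN N f -> biperiodic f.
Proof. by move=> /in_XNP[a [b ->]]; exact: trig_biperiodic. Qed.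

Lemma in_XN_d1 N f : in_XN N f -> in_XN N (d1 f).
Proof. by move=> /in_XNP[a [b ->]]; apply/in_XNP; rewrite d1_trig; eexists; eexists. Qed.

Lemma in_XN_d2 N f : in_XN N f -> in_XN N (d2 f).
Proof. by move=> /in_XNP[a [b ->]]; apply/in_XNP; rewrite d2_trig; eexists; eexists. Qed.

Lemma in_XN_PiN N h : in_XN N (PiN N h).
Proof. by rewrite PiN_trig; apply/in_XNP; eexists; eexists. Qed.

Lemma fcoef_d1 N f k : in_XN N f -> fcoef (d1 f) k = 'i%C * k.1%:~R * fcoef f k.
Proof.
move=> hf; rewrite /fcoef fourier_d1; first by ring.
- exact: in_XN_biperiodic hf.
- by move=> x; exact: in_XN_differentiable hf.
- exact: in_XN_continuous (in_XN_d1 _ _ hf).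
Qed.

Lemma fcoef_d2 N f k : in_XN N f -> fcoef (d2 f) k = 'i%C * k.2%:~R * fcoef f k.
Proof.
move=> hf; rewrite /fcoef fourier_d2; first by ring.
- exact: in_XN_biperiodic hf.
- by move=> x; exact: in_XN_differentiable hf.
- exact: in_XN_continuous (in_XN_d2 _ _ hf).
Qed.

Lemma fcoefD f g k : cellint f -> cellint g ->
  fcoef (fun x => f x + g x) k = fcoef f k + fcoef g k.
Proof. by move=> hf hg; rewrite /fcoef fourierD // mulrDr. Qed.

Lemma fcoefZ (c : R) f k : cellint f -> fcoef (fun x => c * f x) k = real_complex R c * fcoef f k.
Proof. by move=> hf; rewrite /fcoef fourierZ // mulrCA. Qed.

Definition expk k x : R[i] := Complex (cosk k x) (sink k x).

Lemma expk_mul_conj m k x : expk m x * conjc (expk k x) = conjc (expk (k - m) x).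
Proof. by apply: complexP; rewrite /= ?coskB ?sinkB; ring. Qed.

(* The coefficients at k and -k are conjugate, so the imaginary part of the
   Fourier sum vanishes. *)
Lemma sum_fcoef_expk N f x : in_XN N f ->
  \sum_(k <- modes N) fcoef f k * expk k x = real_complex R (f x).
Proof.
move=> hf; have cf := in_XN_cellint _ _ hf.
apply: complexP.
  rewrite Re_sum -[RHS]/(f x) -[in RHS](PiN_id _ _ hf) PiN_trig; apply: eq_bigr => k _.
  by case: (fcoef f k) => u v /=; ring.
rewrite Im_sum -[RHS]/0; set S := LHS; suff : S = - S by lra.
rewrite {2}/S -(sum_modesN _ N (fun k => Im (fcoef f k * expk k x))) -sumrN.
apply: eq_bigr => k _; rewrite fcoef_conj //.
by case: (fcoef f k) => u v /=; rewrite coskN sinkN; ring.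
Qed.

(** Only g is expanded: multiplying conj(e_k) by the mode m of g gives conj(e_{k-m}), so the finite
    sum leaves the integral and f may be any continuous function. *)
Lemma fourierM N f g k : continuous f -> in_XN N g ->
  fourier (fun x => f x * g x) k = \sum_(m <- modes N) fcoef g m * fourier f (k - m).
Proof.
move=> cf hg; have cg := in_XN_continuous _ _ hg.
have intf := continuous_cellint _ cf.
have E x : real_complex R (g x) * conjc (expk k x) =
    \sum_(m <- modes N) fcoef g m * conjc (expk (k - m) x).
  rewrite -(sum_fcoef_expk N) // mulr_suml; apply: eq_bigr => m _.
  by rewrite -mulrA expk_mul_conj.
have intc m : cellint (fun x => f x * cosk m x) by exact: cellint_cos.
have ints m : cellint (fun x => f x * sink m x) by exact: cellint_sin.
rewrite fourierE; last by apply: continuous_cellint; exact: continuousM2.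
under eq_bigr do rewrite fourierE //.
apply: complexP.
  rewrite Re_sum -[LHS]/(icell _).
  transitivity (icell (fun x => \sum_(m <- modes N)
     (Re (fcoef g m) * (f x * cosk (k - m) x) + Im (fcoef g m) * (f x * sink (k - m) x)))).
    congr icell; apply/funext => x; have := congr1 (@Re R) (E x).
    rewrite Re_sum /= mul0r subr0 => e; rewrite -mulrA e mulr_sumr; apply: eq_bigr => m _.
    by case: (fcoef g m) => u v /=; ring.
  rewrite icell_sum; last by move=> m; apply: cellintD; exact: cellintZ.
  apply: eq_bigr => m _; rewrite icellD ?icellZ //; try exact: cellintZ.
  by case: (fcoef g m) => u v /=; ring.
rewrite Im_sum -[LHS]/(- icell _).
transitivity (- icell (fun x => \sum_(m <- modes N)
   (Re (fcoef g m) * (f x * sink (k - m) x) + - Im (fcoef g m) * (f x * cosk (k - m) x)))).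
  congr (- icell _); apply/funext => x; have := congr1 (@Im R) (E x).
  rewrite Im_sum /= mul0r addr0 mulrN => e.
  rewrite -mulrA -[g x * _]opprK e mulrN mulr_sumr -sumrN; apply: eq_bigr => m _.
  by case: (fcoef g m) => u v /=; ring.
rewrite icell_sum; last by move=> m; apply: cellintD; exact: cellintZ.
rewrite -sumrN; apply: eq_bigr => m _; rewrite icellD ?icellZ //; try exact: cellintZ.
by case: (fcoef g m) => u v /=; ring.
Qed.

Lemma fcoefM N f g k : continuous f -> in_XN N g ->
  fcoef (fun x => f x * g x) k = \sum_(m <- modes N) fcoef g m * fcoef f (k - m).
Proof.
move=> cf hg; rewrite /fcoef (fourierM N) // mulr_sumr.
by apply: eq_bigr => m _; rewrite mulrCA.
Qed.

(** This is the coefficient at 0 of f times f: the convolution pairs m with -m, whose coefficients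
    are conjugate since f is real. *)
Lemma parseval N f : in_XN N f ->
  icell (fun x => f x ^+ 2) = area * \sum_(k <- modes N) Normc.normc (fcoef f k) ^+ 2.
Proof.
move=> hf; have cf := in_XN_continuous _ _ hf.
have a0 : area != 0 :> R by rewrite gt_eqF ?area_gt0.
have := fcoefM N f f 0 cf hf; rewrite [in LHS]/fcoef fourierE; last first.
  by apply: continuous_cellint; exact: continuousM2.
move=> /(congr1 (@Re R)); rewrite Re_realM Re_sum -[Re (Complex _ _)]/(icell _).
have -> : (fun x => f x * f x * cosk 0 x) = (fun x => f x ^+ 2).
  by apply/funext => x; rewrite /cosk dotk0 cos0 mulr1 expr2.
move=> /(congr1 (fun t => area * t)); rewrite mulrA divff // mul1r => ->.
congr (_ * _); apply: eq_bigr => k _; rewrite sub0r -Re_mul_conj.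
by rewrite -fcoef_conj //; exact: in_XN_cellint hf.
Qed.

End Truncation.

(** * Norms and the scheme in Fourier coefficients *)

Section Norms.
Context {R : realType}.
Import complex.
Implicit Types (u : R * R -> R * R) (f : R * R -> R) (k : int * int) (N : nat) (s : R).

Lemma area_neq0 : area != 0 :> R.
Proof. by rewrite gt_eqF ?area_gt0. Qed.

Definition uamp u : int * int -> R := amp (fcoef (cmp1 u)) (fcoef (cmp2 u)).

Lemma L2norm_in_XN N u : in_XN N (cmp1 u) -> in_XN N (cmp2 u) ->
  L2norm u = (Num.sqrt area * wnorm N (fun=> 1) (uamp u))%:E.
Proof.
move=> h1 h2; have c1 := in_XN_continuous _ _ h1; have c2 := in_XN_continuous _ _ h2.
pose g x := cmp1 u x ^+ 2 + cmp2 u x ^+ 2.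
have sq f : continuous f -> cellint (fun x => f x ^+ 2).
  move=> cf; apply: continuous_cellint; under eq_fun do rewrite expr2.
  exact: continuousM2.
have intg : cellint g by apply: cellintD; exact: sq.
have -> : L2norm u = sqrte (icell g)%:E.
  congr sqrte; exact: esym (fineK (integrable_fin_num cell_measurable intg)).
rewrite icellD; [|exact: sq..].
rewrite (parseval N) // (parseval N) // -mulrDr /= sqrtrM ?(ltW area_gt0) //.
congr (_ * Num.sqrt _)%:E; rewrite -big_split /=; apply: eq_bigr => k _.
by rewrite mul1r sqr_amp.
Qed.

Lemma fourier_fcoef f k : fourier f k = real_complex R area * fcoef f k.
Proof. by rewrite /fcoef mulrA -rmorphM divff ?area_neq0 // mul1r. Qed.

(** The infinite sum reduces to the box, outside of which the coefficients vanish. The prefactor is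
    (2 pi)^{-1} from the norm times (2 pi)^2 from the normalisation of [fcoef]. *)
Lemma Hsnorm_in_XN N s u : in_XN N (cmp1 u) -> in_XN N (cmp2 u) ->
  Hsnorm s u = (2 * pi * wnorm N (sobolev_weight s) (uamp u))%:E.
Proof.
move=> h1 h2; rewrite /Hsnorm.
pose F k : R := sobolev_weight s k * (Normc.normc (fourier (cmp1 u) k) ^+ 2 +
       Normc.normc (fourier (cmp2 u) k) ^+ 2).
have F0 k : 0 <= F k.
  by apply: mulr_ge0; [exact: ltW (sobolev_weight_gt0 s k) | rewrite addr_ge0 ?sqr_ge0].
have FE k : F k = area ^+ 2 * (sobolev_weight s k * uamp u k ^+ 2).
  rewrite /F sqr_amp !fourier_fcoef !Normc.normcM /= expr0n addr0 sqrtr_sqr.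
  by rewrite ger0_norm ?(ltW area_gt0) //; ring.
have -> : (\esum_(k in [set: int * int]) (F k)%:E = (\sum_(k <- modes N) F k)%:E)%E.
  rewrite -sumEFin fsbig_seq ?modes_uniq // -esum_fset; last 2 first.
  - exact: finite_seq.
  - by move=> k _; rewrite lee_fin.
  rewrite [RHS]esum_mkcond; apply: eq_esum => k _.
  case: ifPn => // km; congr EFin; rewrite FE /uamp.
  have km' : k \notin modes N by apply: contra km => km; rewrite inE.
  by rewrite /amp !(fcoef_notin N) // Normc.normc0 expr0n addr0 sqrtr0 expr0n !mulr0.
rewrite /= -EFinM; congr EFin.
under eq_bigr do rewrite FE.
rewrite -mulr_sumr sqrtrM ?sqr_ge0 // sqrtr_sqr ger0_norm ?(ltW area_gt0) //.
rewrite -/(wnorm N (sobolev_weight s) (uamp u)) /area.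
by have := pi_gt0 R; move: (pi : R) => P P0; field; rewrite gt_eqF.
Qed.

Lemma Hsnorm_PiN_le N s u : cellint (cmp1 u) -> cellint (cmp2 u) ->
  (Hsnorm s (componentwise (PiN N) u) <= Hsnorm s u)%E.
Proof.
move=> i1 i2; rewrite /Hsnorm.
have H f k : cellint f -> Normc.normc (fourier (PiN N f) k) ^+ 2 <= Normc.normc (fourier f k) ^+ 2.
  move=> hf; rewrite fourier_fcoef fcoef_PiN //; case: ifP => _; first by rewrite -fourier_fcoef.
  by rewrite mulr0 Normc.normc0 expr0n sqr_ge0.
have E0 (v : R * R -> R * R) k : 0 <= (1 + normk k `^ (2 * s)) *
      (Normc.normc (fourier (cmp1 v) k) ^+ 2 + Normc.normc (fourier (cmp2 v) k) ^+ 2).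
  by rewrite mulr_ge0 ?addr_ge0 ?sqr_ge0 ?powR_ge0.
apply: lee_wpmul2l; first by rewrite lee_fin invr_ge0 (ltW pi2_gt0).
rewrite lee_sqrt; last by apply: esum_ge0 => k _; rewrite lee_fin E0.
apply: le_esum => k _; rewrite lee_fin.
by rewrite ler_wpM2l ?addr_ge0 ?powR_ge0 // lerD // H.
Qed.

(** On a cell of finite measure square integrability suffices, through |f| <= 1 + f^2. *)
Lemma in_Hs_cellint s u : in_Hs s u -> cellint (cmp1 u) /\ cellint (cmp2 u).
Proof.
move=> [_ [m1 m2] L2 _].
pose g x := cmp1 u x ^+ 2 + cmp2 u x ^+ 2.
have g0 x : 0 <= g x by rewrite addr_ge0 ?sqr_ge0.
have intg : cellint g.
  apply/integrableP; split.
    apply/measurable_EFinP; apply: measurable_funTS.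
    by apply: measurable_funD; apply: measurable_funX.
  rewrite [X in (X < _)%E](_ : _ = \int[mu2]_(x in cell) (g x)%:E)%E; last first.
    by apply: eq_integral => x _; rewrite /= ger0_norm.
  move: L2; rewrite /L2norm -/(g _).
  set I := integral _ _ _ => I2.
  rewrite ltey; apply/eqP => Iy; move: I2; rewrite -[X in sqrte X]/I Iy.
  by rewrite /= ltxx.
have int1 : cellint (fun x => 1 + g x).
  by apply: cellintD => //; apply: continuous_cellint => x; exact: cvg_cst.
have dom f : measurable_fun [set: plane] f -> (forall x, f x ^+ 2 <= g x) -> cellint f.
  move=> mf fg; apply: le_integrable int1.
  - exact: cell_measurable.
  - by apply/measurable_EFinP; exact: measurable_funTS.
  move=> x _; have g1 : 0 <= 1 + g x by exact: addr_ge0.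
  rewrite /= lee_fin (ger0_norm g1).
  have ft : `|f x| ^+ 2 <= g x by rewrite real_normK ?num_real.
  have := sqr_ge0 (`|f x| - 1); have := normr_ge0 (f x); nra.
split; apply: dom => // x; first by rewrite /g lerDl sqr_ge0.
by rewrite /g lerDr sqr_ge0.
Qed.

Lemma cosk_trig k : cosk k = trig [:: k] (fun=> 1) (fun=> 0) :> (R * R -> R).
Proof. by apply/funext => x; rewrite /trig big_seq1 mul1r mul0r addr0. Qed.

Lemma sink_trig k : sink k = trig [:: k] (fun=> 0) (fun=> 1) :> (R * R -> R).
Proof. by apply/funext => x; rewrite /trig big_seq1 mul1r mul0r add0r. Qed.

(** Testing with sin(k.x), whose gradient is k cos(k.x), gives the real part; testing with cos(k.x)
    gives the imaginary part. *)
Lemma weakly_div_free_fcoef u k : cellint (cmp1 u) -> cellint (cmp2 u) ->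
  weakly_div_free u -> cdot k (fcoef (cmp1 u) k) (fcoef (cmp2 u) k) = 0.
Proof.
move=> i1 i2 div0.
have C : k.1%:~R * icell (fun x => cmp1 u x * cosk k x) + k.2%:~R * icell (fun x => cmp2 u x * cosk k x) = 0.
  rewrite -!icellZ; [|exact: cellint_cos..].
  rewrite -icellD; [|by apply: cellintZ; exact: cellint_cos..].
  rewrite -[RHS](div0 (sink k) (sink_biperiodic k)); last by rewrite sink_trig; exact: smooth_trig.
  by apply: eq_Rintegral => x _; rewrite d1_sink d2_sink /cmp1 /cmp2; ring.
have S : k.1%:~R * icell (fun x => cmp1 u x * sink k x) + k.2%:~R * icell (fun x => cmp2 u x * sink k x) = 0.
  rewrite -!icellZ; [|exact: cellint_sin..].
  rewrite -icellD; [|by apply: cellintZ; exact: cellint_sin..].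
  apply: oppr_inj; rewrite -icellN ?oppr0; last first.
    by apply: cellintD; apply: cellintZ; exact: cellint_sin.
  rewrite -[RHS](div0 (cosk k) (cosk_biperiodic k)); last by rewrite cosk_trig; exact: smooth_trig.
  by apply: eq_Rintegral => x _; rewrite d1_cosk d2_cosk /cmp1 /cmp2; ring.
rewrite /cdot /fcoef mulrCA [_ * (_ * fourier (cmp2 u) k)]mulrCA -mulrDr.
rewrite -!(rmorph_int (real_complex R)) !fourierE //.
rewrite (_ : _ + _ = 0) ?mulr0 //; apply: complexP => /=; first by rewrite !mul0r !subr0 C.
by rewrite !mul0r !addr0 !mulrN -opprD S oppr0.
Qed.

Lemma fcoef_advect N u f k : in_XN N (cmp1 u) -> in_XN N (cmp2 u) -> in_XN N f ->
  fcoef (advect u f) k = \sum_(m <- modes N)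
     'i%C * cdot m (fcoef (cmp1 u) (k - m)) (fcoef (cmp2 u) (k - m)) * fcoef f m.
Proof.
move=> h1 h2 hf; have [d1f d2f] := (in_XN_d1 _ _ hf, in_XN_d2 _ _ hf).
have c1 := in_XN_continuous _ _ h1; have c2 := in_XN_continuous _ _ h2.
rewrite [LHS](fcoefD (fun x => cmp1 u x * d1 f x) (fun x => cmp2 u x * d2 f x)).
- rewrite !(fcoefM N) // -big_split /=; apply: eq_bigr => m _.
  by rewrite (fcoef_d1 N f) // (fcoef_d2 N f) // /cdot; ring.
- by apply: continuous_cellint; apply: continuousM2 => //; exact: in_XN_continuous d1f.
- by apply: continuous_cellint; apply: continuousM2 => //; exact: in_XN_continuous d2f.
Qed.

Lemma in_XN_lap_continuous N f : in_XN N f -> continuous (laplacian f).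
Proof.
move=> hf; apply: continuousD2; apply: (@in_XN_continuous _ N).
  exact/in_XN_d1/in_XN_d1.
exact/in_XN_d2/in_XN_d2.
Qed.

Lemma fcoef_laplacian N f k : in_XN N f ->
  fcoef (laplacian f) k = - real_complex R (normk k ^+ 2) * fcoef f k.
Proof.
move=> hf; have [d1f d2f] := (in_XN_d1 _ _ hf, in_XN_d2 _ _ hf).
rewrite [LHS](fcoefD (d1 (d1 f)) (d2 (d2 f))); first last.
- exact: in_XN_cellint (in_XN_d2 _ _ d2f).
- exact: in_XN_cellint (in_XN_d1 _ _ d1f).
have e1 := etrans (fcoef_d1 N (d1 f) k d1f) (congr1 _ (fcoef_d1 N f k hf)).
have e2 := etrans (fcoef_d2 N (d2 f) k d2f) (congr1 _ (fcoef_d2 N f k hf)).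
apply: etrans (congr2 +%R e1 e2) _.
rewrite sqr_normk -!(rmorph_int (real_complex R)).
have -> : 'i%C * real_complex R k.1%:~R * ('i%C * real_complex R k.1%:~R * fcoef f k) +
    'i%C * real_complex R k.2%:~R * ('i%C * real_complex R k.2%:~R * fcoef f k) =
    'i%C ^+ 2 * (real_complex R k.1%:~R ^+ 2 + real_complex R k.2%:~R ^+ 2) * fcoef f k by ring.
by rewrite sqr_i mulN1r rmorphD !rmorphXn.
Qed.

(* [dp] is a partial derivative of the pressure, which is not assumed to be
   continuous: continuity, needed to compute its coefficients by parts, follows
   from the momentum equation itself. *)
Lemma momentum_fcoef N (tau nu : R) u f g (dp : R * R -> R) (q : int * int -> R[i]) :
  in_XN N f -> in_XN N g -> in_XN N (cmp1 u) -> in_XN N (cmp2 u) ->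
  (continuous dp -> forall k, fcoef dp k = q k) ->
  (forall x, tau^-1 * (g x - f x) + PiN N (advect u g) x + dp x = nu * laplacian g x) ->
  forall k, k \in modes N ->
    real_complex R tau^-1 * (fcoef g k - fcoef f k)
    + \sum_(m <- modes N) 'i%C * cdot m (fcoef (cmp1 u) (k - m)) (fcoef (cmp2 u) (k - m)) * fcoef g m
    + q k = - real_complex R (nu * normk k ^+ 2) * fcoef g k.
Proof.
move=> hf hg h1 h2 hq step k km.
have [cf cg] := (in_XN_continuous _ _ hf, in_XN_continuous _ _ hg).
have cP := in_XN_continuous _ _ (in_XN_PiN N (advect u g)).
have cL := in_XN_lap_continuous _ _ hg.
have cA : continuous (advect u g).
  apply: continuousD2; apply: continuousM2.
  - exact: in_XN_continuous h1.
  - exact: in_XN_continuous (in_XN_d1 _ _ hg).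
  - exact: in_XN_continuous h2.
  - exact: in_XN_continuous (in_XN_d2 _ _ hg).
have dpE : dp = fun x => (nu * laplacian g x + - tau^-1 * (g x + -1 * f x)) + -1 * PiN N (advect u g) x.
  by apply/funext => x; rewrite -step; ring.
have c1 : continuous (fun x => g x + -1 * f x) by apply: continuousD2 => //; exact: continuousZ2.
have c2 : continuous (fun x => nu * laplacian g x + - tau^-1 * (g x + -1 * f x)).
  by apply: continuousD2; exact: continuousZ2.
have cdp : continuous dp by rewrite dpE; apply: continuousD2 => //; exact: continuousZ2.
have cc := @continuous_cellint R; have cz := @continuousZ2 R.
have E : fcoef dp k = real_complex R nu * fcoef (laplacian g) k
    + real_complex R (- tau^-1) * (fcoef g k + real_complex R (-1) * fcoef f k)
    + real_complex R (-1) * fcoef (PiN N (advect u g)) k.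
  rewrite dpE fcoefD; [|exact: cc|by apply: cc; exact: cz].
  rewrite fcoefD; [|by apply: cc; exact: cz..].
  rewrite !(fcoefZ _ (laplacian g), fcoefZ _ (PiN N (advect u g)),
    fcoefZ _ (fun x => g x + -1 * f x)); [|exact: cc..].
  rewrite (fcoefD g); [|exact: cc|by apply: cc; exact: cz].
  by rewrite fcoefZ //; exact: cc.
rewrite -(hq cdp) E fcoef_PiN ?km; last exact: cc.
rewrite (fcoef_advect N) // (fcoef_laplacian N) // !rmorphN rmorph1 rmorphM /=; ring.
Qed.

End Norms.

(** * The two estimates for the iterates of the scheme *)

Section Scheme.
Context {R : realType}.
Import complex.
Context {N M : nat} {nu tau : R} {u0 : R * R -> R * R}
  {u : nat -> R * R -> R * R} {p : nat -> R * R -> R}.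
Hypotheses (sch : semi_implicit_scheme N nu tau M u0 u p)
  (nu0 : 0 < nu) (tau0 : 0 < tau)
  (int1 : cellint (cmp1 u0)) (int2 : cellint (cmp2 u0)) (div0 : weakly_div_free u0).

Let ucoef1 n := fcoef (cmp1 (u n)).
Let ucoef2 n := fcoef (cmp2 (u n)).

(** The constraint of the scheme only concerns u^{n+1}. For n = 0 the property comes from the weak
    divergence of the initial field, and truncation either keeps or removes both components of a
    mode. *)
Lemma scheme_div_free n k : (n <= M.+1)%N -> cdot k (ucoef1 n k) (ucoef2 n k) = 0.
Proof.
case: n => [_|n nM].
  have -> : ucoef1 0%N = fcoef (PiN N (cmp1 u0)).
    by congr fcoef; apply/funext => x; rewrite /cmp1 (scheme_init sch).
  have -> : ucoef2 0%N = fcoef (PiN N (cmp2 u0)).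
    by congr fcoef; apply/funext => x; rewrite /cmp2 (scheme_init sch).
  rewrite !fcoef_PiN //; case: ifP => _; first exact: weakly_div_free_fcoef.
  by rewrite /cdot !mulr0 addr0.
have [h1 h2] := scheme_XN sch nM.
have E : fcoef (fun x => d1 (cmp1 (u n.+1)) x + d2 (cmp2 (u n.+1)) x) k = 0.
  have -> : (fun x => d1 (cmp1 (u n.+1)) x + d2 (cmp2 (u n.+1)) x) = trig [::] (fun=> 0) (fun=> 0).
    by rewrite trig_nil; apply/funext => x; exact: (scheme_div sch nM x).
  by rewrite /fcoef fourier_trig big_nil mulr0.
rewrite fcoefD in E.
- have e1 := fcoef_d1 N (cmp1 (u n.+1)) k h1; have e2 := fcoef_d2 N (cmp2 (u n.+1)) k h2.
  have {}E := etrans (esym (congr2 +%R e1 e2)) E.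
  have i0 : 'i%C != 0 :> R[i] by rewrite eq_complex /= negb_and oner_eq0 orbT.
  by apply: (mulfI i0); rewrite mulr0 -[RHS]E /cdot /ucoef1 /ucoef2; ring.
- exact: in_XN_cellint (in_XN_d1 _ _ h1).
- exact: in_XN_cellint (in_XN_d2 _ _ h2).
Qed.

(** Common source of both claims: w = 1 for the energy, w = [sobolev_weight s] for the Sobolev
    bound. *)
Lemma scheme_energy_le (w : int * int -> R) n : (n <= M)%N -> (forall k, 0 <= w k) ->
  wnorm N w (uamp (u n.+1)) ^+ 2 <=
  wnorm N w (uamp (u n)) * wnorm N w (uamp (u n.+1))
  + tau / 2 * \sum_(k <- modes N) \sum_(m <- modes N)
     `|w k - w m| * `|transfer (ucoef1 n) (ucoef2 n) (ucoef1 n.+1) (ucoef2 n.+1) k m|.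
Proof.
move=> nM w0; have nM1 : (n <= M.+1)%N by exact: leqW.
have [a1 a2] := scheme_XN sch nM1; have [b1 b2] := scheme_XN sch (nM : (n.+1 <= M.+1)%N).
have [pp dp] := scheme_pressure sch nM.
have step x := scheme_step sch nM x.
have st1 := momentum_fcoef N tau nu (u n) (cmp1 (u n)) (cmp1 (u n.+1)) (d1 (p n))
  (fun k => 'i%C * k.1%:~R * fcoef (p n) k) a1 b1 a1 a2.
have st2 := momentum_fcoef N tau nu (u n) (cmp2 (u n)) (cmp2 (u n.+1)) (d2 (p n))
  (fun k => 'i%C * k.2%:~R * fcoef (p n) k) a2 b2 a1 a2.
have dot := sum_Re_dot_le N w (ucoef1 n) (ucoef2 n) (ucoef1 n.+1) (ucoef2 n.+1) w0.
rewrite sqr_wnorm //; apply: (le_trans _ (lerD dot (lexx _))).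
apply: (energy_le _ _ _ N tau nu w _ _ (fcoef (p n))) => //.
- by move=> k; rewrite /ucoef1 fcoef_conj //; exact: in_XN_cellint a1.
- by move=> k; rewrite /ucoef2 fcoef_conj //; exact: in_XN_cellint a2.
- by move=> k; exact: scheme_div_free.
- exact: ltW.
- by move=> k; exact: scheme_div_free.
- apply: st1 => [cdp k|x]; last exact: (congr1 (@fst R R) (step x)).
  by rewrite /fcoef fourier_d1 //; ring.
- apply: st2 => [cdp k|x]; last exact: (congr1 (@snd R R) (step x)).
  by rewrite /fcoef fourier_d2 //; ring.
Qed.

Lemma scheme_L2norm_le n : (n <= M)%N -> (L2norm (u n.+1) <= L2norm (u n))%E.
Proof.
move=> nM; have nM1 : (n <= M.+1)%N by exact: leqW.
have [a1 a2] := scheme_XN sch nM1; have [b1 b2] := scheme_XN sch (nM : (n.+1 <= M.+1)%N).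
rewrite !(L2norm_in_XN N) // lee_fin ler_wpM2l ?sqrtr_ge0 //.
have := scheme_energy_le (fun=> 1) n nM (fun=> ler01).
rewrite big1 ?mulr0 ?addr0 => [|k _]; last first.
  by rewrite big1 // => m _; rewrite subrr normr0 mul0r.
set y := wnorm _ _ _; set z := wnorm _ _ (uamp (u n)).
have z0 : 0 <= z by exact: wnorm_ge0.
have [->//|y1] := eqVneq y 0.
have y0 : 0 < y by rewrite lt_neqAle eq_sym y1 wnorm_ge0.
by rewrite expr2 ler_pM2r.
Qed.

Lemma scheme_sobolev_le (s : R) : 2 < s ->
  tau * M%:R * growth_const s * wnorm N (sobolev_weight s) (uamp (u 0%N)) <= 4^-1 ->
  forall n, (n <= M)%N ->
  wnorm N (sobolev_weight s) (uamp (u n)) <= 4 * wnorm N (sobolev_weight s) (uamp (u 0%N)).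
Proof.
move=> s2 small; have G0 := growth_const_gt0 s s2.
have w0 k : 0 <= sobolev_weight s k by exact: ltW (sobolev_weight_gt0 s k).
apply: (quadratic_growth_le (fun n => wnorm N (sobolev_weight s) (uamp (u n))) (tau * growth_const s)).
- by move=> n; exact: wnorm_ge0.
- by rewrite mulr_ge0 // ltW.
- by move: small; rewrite [tau * M%:R * _]mulrAC.
move=> n nM; have nM1 : (n <= M.+1)%N by lia.
apply: le_trans (scheme_energy_le _ n (ltnW nM) w0) _; rewrite lerD2l.
rewrite -mulrA -[tau * growth_const s * _]mulrA ler_pM2l //.
have [a1 a2] := scheme_XN sch nM1.
apply: sum_weighted_transfer_le => // [k|k km]; first exact: scheme_div_free.
by split; exact: fcoef_notin km.
Qed.

End Scheme.

Theorem theorem1p1 (R : realType) (s : R) (hs : 2 < s) (r : R) :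
  exists T : R, 0 < T /\
    forall u0 : R * R -> R * R,
      in_Hs s u0 -> weakly_div_free u0 -> Hsnorm s u0 = r%:E ->
      forall (N : nat) (nu : R) (M : nat),
        (2 <= N)%N -> 0 < nu -> (0 < M)%N ->
        forall (u : nat -> R * R -> R * R) (p : nat -> R * R -> R),
          semi_implicit_scheme N nu (T / M%:R) M u0 u p ->
          (forall n : nat, (n <= M)%N ->
             (L2norm (u n.+1) <= L2norm (u n))%E) /\
          (ereal_sup [set Hsnorm s (u n) | n in [set n : nat | (n <= M)%N]]
             <= 4%:E * Hsnorm s u0)%E.
Proof.
have G0 := growth_const_gt0 s hs.
have r1 : 0 < `|r| + 1 by rewrite ltr_wpDl.
have T0 : 0 < (4 * growth_const s * (`|r| + 1))^-1 by rewrite invr_gt0; apply: mulr_gt0 => //; apply: mulr_gt0.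
(* T is fixed before any field is given, so [|r| + 1] keeps it positive for every real r, 0
   included. The 4 yields the smallness 1/4 required by the recursion. *)
exists (4 * growth_const s * (`|r| + 1))^-1; split=> //.
move=> u0 hu0 div0 Hr N nu M _ nu0 M0 u p sch.
set T := (4 * _ * _)^-1 in T0 sch.
have M0R : 0 < M%:R :> R by rewrite ltr0n.
have tau0 : 0 < T / M%:R by rewrite divr_gt0.
have [int1 int2] := in_Hs_cellint _ _ hu0.
split; first exact: (scheme_L2norm_le sch).
have XN n : (n <= M)%N -> Hsnorm s (u n) = (2 * pi * wnorm N (sobolev_weight s) (uamp (u n)))%:E.
  by move=> nM; have [a1 a2] := scheme_XN sch (leqW nM); exact: Hsnorm_in_XN.
have init : (Hsnorm s (u 0%N) <= Hsnorm s u0)%E.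
  have -> : u 0%N = componentwise (PiN N) u0 by apply/funext => x; exact: (scheme_init sch x).
  exact: Hsnorm_PiN_le.
have y0r : 2 * pi * wnorm N (sobolev_weight s) (uamp (u 0%N)) <= r.
  by rewrite -lee_fin -XN // -Hr.
have y0 := wnorm_ge0 N (sobolev_weight s) (uamp (u 0%N)).
have small : T / M%:R * M%:R * growth_const s * wnorm N (sobolev_weight s) (uamp (u 0%N)) <= 4^-1.
  rewrite divfK ?gt_eqF //; set y := wnorm _ _ _ in y0r y0 *.
  have yr : y <= `|r| + 1.
    (* Since 2 pi >= 1, the factor 2 pi between the coefficient norm and the Sobolev norm only
       helps. *)
    have := ler_norm r; have := pi_ge2 R; nra.
  have -> : T * growth_const s * y = 4^-1 * (y / (`|r| + 1)).
    by rewrite /T; field; rewrite !gt_eqF.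
  by rewrite ler_piMr ?invr_ge0 // ler_pdivrMr // mul1r.
apply: ge_ereal_sup => _ [n /= nM <-].
(* The recursion starts from the truncated field; truncation does not increase the norm, so the same
   factor 4 holds with [u0]. *)
apply: le_trans (_ : 4%:E * Hsnorm s (u 0%N) <= _)%E; last first.
  by apply: lee_wpmul2l => //; rewrite lee_fin.
rewrite !XN // -EFinM lee_fin mulrCA ler_pM2l ?pi2_gt0 //.
exact: (scheme_sobolev_le sch).
Qed.
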